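(* Let $q$ be an even prime power and let $\mathcal{H}$ be a non-empty set of solids in $\mathrm{PG}(4,q)$ such that (I) every point of $\mathrm{PG}(4,q)$ lies in either $0$, $\frac12 q^3$ or $\frac12(q^3+q^2)$ solids of $\mathcal{H}$, and (II) every plane of $\mathrm{PG}(4,q)$ which is contained in a solid of $\mathcal{H}$ is contained in at least $\frac12 q$ solids of $\mathcal{H}$. Then the set of points contained in exactly $\frac12(q^3+q^2)$ solids of $\mathcal{H}$ forms a non-singular quadric $Q=Q(4,q)$ of $\mathrm{PG}(4,q)$, and $\mathcal{H}$ is the set of all solids of $\mathrm{PG}(4,q)$ that meet $Q$ in a non-singular hyperbolic quadric $Q^+(3,q)$.
   Context: $\mathrm{PG}(4,q)$ is the 4-dimensional projective space over the finite field with $q$ elements. A solid is a hyperplane (3-dimensional projective subspace) of $\mathrm{PG}(4,q)$; a plane is a 2-dimensional projective subspace. $Q(4,q)$ denotes a non-singular (parabolic) quadric of $\mathrm{PG}(4,q)$, identified with its set of points. *)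

(* Defs.v *)
From HB Require Import structures.
From mathcomp Require Import all_boot all_order all_algebra.

Set Implicit Arguments.
Unset Strict Implicit.
Unset Printing Implicit Defensive.

Import GRing.Theory VectorInternalTheory.

Local Open Scope ring_scope.

(* Subspaces of a vector space over a finite field form a finite type, being   *)
(* represented by canonical square matrices.                                   *)
HB.instance Definition _ (F : finFieldType) (V : vectType F) :=
  [Countable of {vspace V} by <:].
HB.instance Definition _ (F : finFieldType) (V : vectType F) :=
  [Finite of {vspace V} by <:].

(* The subspaces of PG(4, F) of projective dimension k are the subspaces of    *)
(* F^5 of vector dimension k + 1.                                              *)
Notation projsub F k := {U : {vspace 'rV[F]_5} | \dim U == k.+1%N}.

Notation point F := (projsub F 0).
Notation plane F := (projsub F 2).
Notation solid F := (projsub F 3).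

Section ProjectiveSpace.

Variable F : finFieldType.

Local Notation V := 'rV[F]_5.

Definition inside (j k : nat) (X : projsub F j) (Y : projsub F k) : bool :=
  (val X <= val Y)%VS.

Definition solids_through (k : nat) (H : {set solid F}) (X : projsub F k) :
    {set solid F} :=
  [set S in H | inside X S].

(* The form sum_(i, j) A_ij x_i x_j. The matrix A need not be symmetric: all   *)
(* quadratic forms on F^5 arise in this way, also in characteristic 2, and     *)
(* so do all quadratic forms on a subspace of F^5, by restriction.             *)
Definition qform (A : 'M[F]_5) (v : V) : F := (v *m A *m v^T) 0 0.

Definition polar (A : 'M[F]_5) (u v : V) : F :=
  qform A (u + v) - qform A u - qform A v.

(* No singular points on U. The polar form itself may be degenerate on U, as it *)
(* always is when \dim U is odd in characteristic 2 (the nucleus).             *)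
Definition nonsingular_on (A : 'M[F]_5) (U : {vspace V}) : Prop :=
  forall v, v \in U -> qform A v = 0 ->
    (forall w, w \in U -> polar A v w = 0) -> v = 0.

Definition totally_singular (A : 'M[F]_5) (W : {vspace V}) : bool :=
  [forall v : V, (v \in W) ==> (qform A v == 0)].

Definition witt_index_on (A : 'M[F]_5) (U : {vspace V}) : nat :=
  (\max_(W : {vspace V} | (W <= U)%VS && totally_singular A W) \dim W)%N.

(* The points of the quadric with equation qform A = 0 in the projective space *)
(* of the subspace U.                                                          *)
Definition quadric_points (A : 'M[F]_5) (U : {vspace V}) : {set point F} :=
  [set P : point F | (val P <= U)%VS && totally_singular A (val P)].

Definition nonsingular_quadric (U : {vspace V}) (X : {set point F}) : Prop :=
  exists2 A : 'M[F]_5, nonsingular_on A U & X = quadric_points A U.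

(* A non-singular quadric of the projective space of U is hyperbolic when its  *)
(* Witt index is half of the vector space dimension of U.                      *)
Definition hyperbolic_quadric (U : {vspace V}) (X : {set point F}) : Prop :=
  exists A : 'M[F]_5,
    [/\ nonsingular_on A U, (witt_index_on A U).*2 = \dim U
      & X = quadric_points A U].

End ProjectiveSpace.

(* Main.v *)
Require Import Defs.
From HB Require Import structures.
From mathcomp Require Import all_boot all_order all_algebra.
From mathcomp Require Import finfield zify ring.

Set Implicit Arguments.
Unset Strict Implicit.
Unset Printing Implicit Defensive.

Import GRing.Theory.

(** Let Q be the set of points on (q^3 + q^2)/2 solids of H; these points and
    their vectors are called heavy. The proof determines the intersection
    numbers of Q with lines and planes, recovers from them the perpendicularity
    relation of Q, and from that relation the equation of Q.

    Counting. Pairs (point, solid) and triples (point, solid, solid) give two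
    equations for |H| and the numbers of points of each of the three admissible
    weights. As q is a power of 2, they have a single solution
    ([design_parameters]): |H| = q^2 (q^2 + 1)/2, and exactly one point N, the
    future nucleus, lies on no solid of H. Counting pairs inside a subspace
    then expresses its number of heavy points through the number of solids of H
    containing it ([heavy_count_formula]). A line on N has one heavy
    point, a plane off N on m solids of H has 2m + 1 heavy points, a solid of H
    has (q + 1)^2 and any other solid off N has q^2 + 1.

    Planes and lines. Let S be in H. A plane of S lies on at least q/2 solids
    of H by (II), and on at most q because one of its q + 1 solids passes
    through N. So it has between q + 1 and 2q + 1 heavy points. The first two
    moments of these numbers depend only on |S /\ Q| = (q + 1)^2, hence are
    those of a hyperbolic quadric, and they force one of the two extreme values
    ([solid_planes]). Consequently every plane meets Q in 1 mod q points, and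
    counting the planes on a line shows that a line meets Q in 0, 1, 2 or q + 1
    points ([line_cases]).

    Tangent spaces. For P in Q consider the lines on P that are not 2-secants.
    In each plane on P the number of 2-secants on P is divisible by q, so it is
    0 or q, and the other lines on P are all the q + 1 lines or a single one.
    Hence their union is a hyperplane or everything ([tangentD],
    [tangent_comb]), and the latter is excluded by counting
    ([tangent_proper]).

    The equation. Each line on N = <n> carries exactly one point of Q, so Q is
    the zero set of a homogeneous map phi with phi (v + t n) = phi v + t, and
    the tangent spaces say that u _|_ v :<-> phi (u + v) = phi u + phi v is
    linear in v, with a hyperplane as solution set for u outside <n>. All
    vectors are self-perpendicular, which yields coordinates in which the
    relation is that of the standard symplectic form. Comparing two ways to
    expand phi at a e1 + b f1 + c e2 + d f2, and using that all elements of F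
    are squares, phi^2 turns out to be a quadratic form
    ([perp_quadratic]).

    The solids. A solid of H misses N, so the form is non-singular on it, and
    the tangent hyperplane at one of its points cuts it in a plane with more
    than one point of Q, which gives a line of Q. A solid off N that is not in
    H contains no line of Q, and a solid on N is the tangent hyperplane of a
    point of Q, which would be a singular point of any quadric with the same
    points. *)

(** * The parameters of the configuration *)

Lemma pow2_dvd_consec e j : 2 ^ e %| j * j.-1 -> j < 2 ^ e -> j <= 1.
Proof.
case: j => [//|j] /= dv lt; have [oj|ej] := boolP (odd j).
  by move: dv; rewrite Gauss_dvdl ?coprimeXl ?coprime2n // gtnNdvd.
move: dv; rewrite Gauss_dvdr ?coprimeXl ?coprime2n //=.
by case: j lt ej => [//|j] lt _ /dvdn_leq; lia.
Qed.

(** Here k0 = |H|, and s, a, z count the nonzero vectors on (q^3)/2, on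
    (q^3 + q^2)/2 and on no solids of H. Dividing by r q = q^2/2 reduces the
    equations to k = k0/(r q) = q^2 + j. Eliminating s gives
    a (q + 1) = k g (k (q^2 + q + 1) + 2 q - q (q^3 + q^2 + q + 1)), whose sign
    forces j >= 0. Eliminating a gives
    s q = k g (q^3 + q^2 + 1 - j (q^2 + q + 1)), whose sign forces j < q, and
    modulo q it says that q divides j (j - 1). So j is 0 or 1, and j = 0 is
    impossible because q + 1 would divide 2. The three names r, g, e for
    q = 2 r = g + 1 = 2^e keep the equations free of quotients and
    differences. *)
Lemma design_parameters e q r g k0 s a z :
  q = 2 ^ e -> q = r * 2 -> q = g + 1 -> 0 < g -> 0 < k0 ->
  k0 + s * (r * q ^ 2) + a * (r * (q * (q + 1))) = q ^ 4 * k0 ->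
  k0 ^ 2 + s * (r * q ^ 2) ^ 2 + a * (r * (q * (q + 1))) ^ 2 =
    k0 * (q ^ 3 * (k0 + g)) ->
  z + s + a + 1 = q ^ 5 ->
  k0 = r * (q * (q ^ 2 + 1)) /\ z = g.
Proof.
move=> qe qr qg g0 k0p E1 E2 E3.
have consec j : q %| j * j.-1 -> j < q -> j <= 1.
  by rewrite qe; apply: pow2_dvd_consec.
clear qe; have r0 : 0 < r by clear -qr qg g0; lia.
have [k k0E] : exists k, k0 = k * (r * q).
  have cop : coprime (q ^ 2) (q ^ 4 - 1).
    rewrite coprime_pexpl // -(@coprime_pexpl 4) // subn1 coprimenP //.
    by rewrite expn_gt0 qg addn1.
  have dv : r * q %| k0.
    have rq2 : r * q %| q ^ 2 by apply/dvdnP; exists 2; clear -qr; lia.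
    rewrite -(@Gauss_dvdl _ k0 (q ^ 4 - 1)) ?(coprime_dvdl rq2) //.
    apply/dvdnP; exists (s * q + a * (q + 1)); rewrite mulnBr.
    clear -E1; lia.
  by exists (k0 %/ (r * q)); rewrite divnK.
have rq0 : 0 < r * q by rewrite muln_gt0 r0 qg addn1.
have E1' : s * q + a * (q + 1) + k = k * q ^ 4.
  by apply/eqP; rewrite -(eqn_pmul2l rq0); apply/eqP; subst k0; clear -E1; lia.
have E2' : k ^ 2 + s * q ^ 2 + a * (q + 1) ^ 2 = k ^ 2 * q ^ 3 + 2 * k * q * g.
  apply/eqP; rewrite -(eqn_pmul2l rq0) -(eqn_pmul2l rq0); apply/eqP; subst k0.
  transitivity (k * (r * q) * (q ^ 3 * (k * (r * q) + g))); last by rewrite qr; ring.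
  by rewrite -E2; ring.
have k_pos : 0 < k by clear -k0p k0E; case: k k0E => //; lia.
clear E1 E2.
(* The elimination of s: subtract q times E1' from E2'. *)
have aE : a * (q + 1) + k * (q ^ 5 + k) = k * (k * q ^ 3 + 2 * q * g + q).
  by have := congr1 (muln q) E1'; clear -E2'; lia.
have k_ge : q ^ 2 <= k.
  rewrite leqNgt; apply/negP => k_lt.
  have le1 : q ^ 5 + k <= k * q ^ 3 + 2 * q * g + q.
    by rewrite -(leq_pmul2l k_pos) -aE leq_addl.
  have le2 : k.+1 * q ^ 3 <= q ^ 2 * q ^ 3 by rewrite leq_mul2r k_lt orbT.
  have le3 : 2 * q ^ 2 <= q ^ 3 by rewrite [q ^ 3]expnS leq_mul2r qg; lia.
  clear -le1 le2 le3 qg k_lt g0; subst q; lia.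
have [j kE] : exists j, k = q ^ 2 + j by exists (k - q ^ 2); rewrite subnKC.
(* The elimination of a. *)
have sE : s * q + k * (g * (j * (q ^ 2 + q + 1))) = k * (g * (q ^ 3 + q ^ 2 + 1)).
  clear -E1' aE kE qg; subst k q; lia.
have kg0 : 0 < k * g by rewrite muln_gt0 k_pos.
have j_lt : j < q.
  rewrite ltnNge; apply/negP => j_ge.
  have le1 : j * (q ^ 2 + q + 1) <= q ^ 3 + q ^ 2 + 1.
    by rewrite -(leq_pmul2l kg0) -!mulnA -sE leq_addl.
  have le2 : q * (q ^ 2 + q + 1) <= j * (q ^ 2 + q + 1) by rewrite leq_mul2r j_ge orbT.
  clear -le1 le2 qg g0; lia.
have j_le1 : j <= 1.
  apply: consec => //.
  have cop : coprime q g by rewrite qg addn1 coprimeSn.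
  have : q %| g * (k * (q ^ 3 + q ^ 2 + 1) - k * (j * (q ^ 2 + q + 1))).
    apply/dvdnP; exists s; rewrite mulnBr; clear -sE; lia.
  rewrite Gauss_dvdr // => /dvdnP[t tE].
  have le : k * (j * (q ^ 2 + q + 1)) <= k * (q ^ 3 + q ^ 2 + 1).
    by rewrite -(leq_pmul2l g0); clear -sE; lia.
  case: j {j_lt sE} kE tE le => [|j] kE tE le; first by rewrite mul0n.
  (* X and Y collect the terms divisible by q in k * (q ^ 3 + q ^ 2 + 1) and in
     k * (j * (q ^ 2 + q + 1)); what is left over is j.+1 and j.+1 ^ 2. *)
  pose X := q * (q ^ 3 + q ^ 2 + 1) + j.+1 * (q ^ 2 + q).
  pose Y := q * (j.+1 * (q ^ 2 + q + 1)) + j.+1 ^ 2 * (q + 1).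
  have XY : q * X = t * q + q * Y + j.+1 * j.
    by rewrite /X /Y; clear -kE tE le; subst k; lia.
  move: X Y XY => X Y XY; have q0 : 0 < q by rewrite qg addn1.
  have XtY : t + Y <= X by rewrite -(leq_pmul2l q0); clear -XY; lia.
  apply/dvdnP; exists (X - (t + Y)); rewrite mulnBl; clear -XY; lia.
have jE : j = 1.
  case: j kE sE j_lt j_le1 => [|[|//]] kE _ _ _ //; exfalso.
  (* q^3 (q - 1) is 2 modulo q + 1. *)
  have aE' : (q + 1) * (a + 2 * q ^ 2 + 2) = (q + 1) * (q ^ 3 + 2 * q) + 2.
    by clear -aE kE qg; subst k q; lia.
  have lt : q ^ 3 + 2 * q < a + 2 * q ^ 2 + 2.
    by rewrite -(ltn_pmul2l (_ : 0 < q + 1)) ?aE' ?addn1 //; clear; lia.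
  have := leq_mul (leqnn (q + 1)) lt; rewrite aE'; clear -qg g0; lia.
subst j; split; first by rewrite k0E kE; ring.
have {}aE : a = g * ((q + 1) * (q ^ 2 + 1)).
  apply/eqP; rewrite -(eqn_pmul2r (_ : 0 < q + 1)) ?addn1 //.
  by apply/eqP; clear -aE kE qg; subst k q; lia.
have {}sE : s = g * ((q ^ 2 + 1) * (q ^ 2 - 1)).
  apply/eqP; rewrite -(eqn_pmul2r (_ : 0 < q)) ?qg ?addn1 // -addn1 -qg.
  rewrite mulnBr mulnBr mulnBl.
  by apply/eqP; clear -sE kE qg; subst k q; lia.
have q1 : 0 < q ^ 2 by rewrite expn_gt0 qg addn1.
move: E3; rewrite aE sE !mulnBr; clear -qg q1; subst q; lia.
Qed.

Local Open Scope ring_scope.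

(** * Duality in a finite vector space *)

Section Orthogonality.

Variables (F : finFieldType) (n : nat).
Local Notation V := 'rV[F]_n.
Local Notation q := #|F|.

(** The dot product identifies the space with its dual, so that functionals are
    vectors and a single counting lemma serves both. *)
Definition dot (v w : V) : F := (v *m w^T) 0 0.

Lemma dotC v w : dot v w = dot w v.
Proof. by rewrite /dot -[in LHS](trmxK v) -trmx_mul mxE. Qed.

Lemma dotDl u v w : dot (u + v) w = dot u w + dot v w.
Proof. by rewrite /dot mulmxDl mxE. Qed.

Lemma dotZl a v w : dot (a *: v) w = a * dot v w.
Proof. by rewrite /dot -scalemxAl mxE. Qed.

Lemma dotZr a v w : dot v (a *: w) = a * dot v w.
Proof. by rewrite dotC dotZl dotC. Qed.

Lemma dot0l w : dot 0 w = 0.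
Proof. by rewrite -(scale0r (0 : V)) dotZl mul0r. Qed.

Lemma dot0r w : dot w 0 = 0.
Proof. by rewrite dotC dot0l. Qed.

Lemma dot_neq0 v : v != 0 -> exists w, dot v w != 0.
Proof.
move=> /rV0Pn[i vi]; exists (delta_mx 0 i).
by rewrite /dot trmx_delta -colE mxE.
Qed.

Definition hyp (w : V) : {vspace V} := lker (linfun (mulmxr w^T)).

Lemma mem_hyp v w : (v \in hyp w) = (dot v w == 0).
Proof.
rewrite memv_ker lfunE /= /dot; apply/eqP/eqP => [-> | d0]; first by rewrite mxE.
by apply/matrixP => i j; rewrite !ord1 d0 mxE.
Qed.

Lemma mem_hypC v w : (v \in hyp w) = (w \in hyp v).
Proof. by rewrite !mem_hyp dotC. Qed.

Definition orth (X : {vspace V}) : {vspace V} := (\bigcap_(v in X) hyp v)%VS.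

Lemma orthP (X : {vspace V}) w :
  reflect (forall v, v \in X -> dot v w = 0) (w \in orth X).
Proof.
apply: (iffP subv_bigcapP) => h v vX.
  by have := h v vX; rewrite -memvE mem_hyp dotC => /eqP.
by rewrite -memvE mem_hyp dotC h.
Qed.

Lemma sub_hyp (X : {vspace V}) w : (X <= hyp w)%VS = (w \in orth X).
Proof.
apply/subvP/orthP => h v vX; first by apply/eqP; rewrite -mem_hyp h.
by rewrite mem_hyp h.
Qed.

Lemma orthD (X Y : {vspace V}) w :
  (w \in orth (X + Y)) = (w \in orth X) && (w \in orth Y).
Proof. by rewrite -!sub_hyp subv_add. Qed.

Lemma orth_line v : orth <[v]> = hyp v.
Proof.
apply/vspaceP => w; rewrite -sub_hyp -memvE; exact: mem_hypC.
Qed.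

Lemma cardV : #|fullv : {vspace V}| = (q ^ n)%N.
Proof. by rewrite card_vspacef card_mx mul1n. Qed.

Lemma cardv (X : {vspace V}) : #|X| = (q ^ \dim X)%N.
Proof. exact: card_vspace. Qed.

Lemma card_gt1 : (1 < q)%N. Proof. exact: finNzRing_gt1. Qed.

Lemma dim_cap_hyp (X : {vspace V}) w : w \notin orth X ->
  (\dim (X :&: hyp w)).+1 = \dim X.
Proof.
move=> wX; rewrite -(limg_ker_dim (linfun (mulmxr w^T)) X) -addn1.
congr (_ + _)%N; apply/eqP; rewrite eqn_leq lt0n dimv_eq0; apply/andP; split.
  apply: contra wX; rewrite -subv0 => /subvP h; rewrite -sub_hyp.
  apply/subvP => v vX; rewrite memv_ker -memv0.
  exact/h/memv_img.
by rewrite (leq_trans (dimvS (subvf _))) // dimvf /dim /= muln1.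
Qed.

Lemma card_cap_hyp (X : {vspace V}) w : w \notin orth X ->
  #|X| = (q * #|(X :&: hyp w)%VS|)%N.
Proof. by move=> /dim_cap_hyp h; rewrite !cardv -h expnS. Qed.

Lemma dim_add_line (X : {vspace V}) v : v \notin X ->
  \dim (X + <[v]>) = (\dim X).+1.
Proof.
move=> vX; have v0 : v != 0 by apply: contraNneq vX => ->; rewrite mem0v.
rewrite dimv_disjoint_sum; first by rewrite dim_vline v0 addn1.
apply/eqP; rewrite -subv0; apply/subvP => u; rewrite memv_cap => /andP[uX].
move=> /vlineP[a uE]; have [a0|a0] := eqVneq a 0; first by rewrite uE a0 scale0r mem0v.
by case/negP: vX; rewrite -[v]scale1r -(mulVf a0) -scalerA -uE memvZ.
Qed.

Lemma sum_cap_hyp (X : {vspace V}) (B : {pred V}) :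
  (\sum_(w in B) #|(X :&: hyp w)%VS| = \sum_(v in X) #|[predI B & hyp v]|)%N.
Proof.
transitivity (\sum_(w in B) \sum_(v in X) (w \in hyp v : nat))%N.
  apply: eq_bigr => w _; rewrite -sum1_card big_mkcond [RHS]big_mkcond /=.
  by apply: eq_bigr => v _; rewrite memv_cap mem_hypC; case: (v \in X) (w \in _).
rewrite exchange_big; apply: eq_bigr => v _.
rewrite -sum1_card big_mkcond [RHS]big_mkcond /=; apply: eq_bigr => w _.
by rewrite inE /=; case: (w \in B); case: (w \in _).
Qed.

(** A hyperplane cuts a subspace X in |X| or |X|/q vectors; both sides are
    multiplied by q to stay within natural numbers. This is the double count on
    which everything rests. *)
Lemma sum_card_cap_hyp (X : {vspace V}) (B : {pred V}) :
  (q * (\sum_(w in B) #|(X :&: hyp w)%VS|) + #|X| * #|[predI B & orth X]| =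
   #|X| * #|B| + q * #|X| * #|[predI B & orth X]|)%N.
Proof.
rewrite (bigID (mem (orth X))) /= -(cardID (mem (orth X)) B).
have -> : (\sum_(w in B | w \in orth X) #|(X :&: hyp w)%VS|
           = #|[predI B & orth X]| * #|X|)%N.
  rewrite -sum_nat_const; apply: eq_big => [w|w /andP[_ wX]]; first by rewrite inE.
  by rewrite (capv_idPl _) // sub_hyp.
have : (q * (\sum_(w in B | w \notin orth X) #|(X :&: hyp w)%VS|)
           = #|[predD B & orth X]| * #|X|)%N.
  rewrite big_distrr /= -sum_nat_const.
  apply: eq_big => [w|w /andP[_ wX]]; first by rewrite inE /= andbC.
  by rewrite -card_cap_hyp.
move=> h; rewrite mulnDr h; ring.
Qed.

Lemma card_hyp v : v != 0 -> (q * #|hyp v| = q ^ n)%N.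
Proof.
move=> /dot_neq0[w vw]; have /card_cap_hyp : v \notin orth {: V}%VS.
  by apply/negP => /orthP /(_ w (memvf _)) /eqP; rewrite dotC (negPf vw).
by rewrite capfv => <-; rewrite cardV.
Qed.

(** Double counting: summing |X /\ hyp w| over all w in two ways leaves |orth X|
    as the only unknown, since all hyp v with v nonzero have the same size. *)
Lemma card_orth (X : {vspace V}) : (#|X| * #|orth X| = q ^ n)%N.
Proof.
have := sum_card_cap_hyp X (mem (fullv : {vspace V})).
have -> : #|[predI mem (fullv : {vspace V}) & orth X]| = #|orth X|.
  by apply: eq_card => v; rewrite inE /= memvf.
rewrite sum_cap_hyp (bigD1 0) ?mem0v //= !cardV.
have -> : #|[predI (fullv : {vspace V}) & hyp 0]| = (q ^ n)%N.
  by rewrite -cardV; apply: eq_card => w; rewrite inE /= !memvf mem_hyp dot0r eqxx.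
have -> : (q * (q ^ n + \sum_(v in X | v != 0%R) #|[predI (fullv : {vspace V}) & hyp v]|)
  = q * q ^ n + #|X|.-1 * q ^ n)%N.
  rewrite mulnDr; congr (_ + _)%N; rewrite big_distrr /=.
  have -> : #|X|.-1 = #|[predD1 X & 0]| by rewrite (cardD1 0 X) mem0v.
  rewrite -sum_nat_const; apply: eq_big => [v|v /andP[_ v0]].
    by rewrite inE /= andbC.
  by rewrite -(card_hyp v0); congr (_ * _)%N; apply: eq_card => w; rewrite inE /= memvf.
have X0 : (0 < #|X|)%N by rewrite (cardD1 0) mem0v.
move: card_gt1 X0 (q ^ n)%N #|orth X| => q1 + Q o.
case: q q1 => // -[//|k] _; case: #|X| => // x _ /= h.
by apply/eqP; rewrite -(eqn_pmul2l (ltn0Sn k)); apply/eqP; lia.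
Qed.

Lemma dim_orth (X : {vspace V}) : (\dim X + \dim (orth X) = n)%N.
Proof.
by have /eqP := card_orth X; rewrite !cardv -expnD eqn_exp2l ?card_gt1 // => /eqP.
Qed.

Lemma orthK (X : {vspace V}) : orth (orth X) = X.
Proof.
apply/esym/eqP; rewrite eqEdim; apply/andP; split.
  by apply/subvP => v vX; apply/orthP => w /orthP /(_ v vX); rewrite dotC.
by have := dim_orth X; have := dim_orth (orth X); lia.
Qed.

End Orthogonality.

(** * Quadratic forms *)

Section Forms.

Variable F : finFieldType.
Local Notation V := 'rV[F]_5.

Lemma qformZ A a (v : V) : qform A (a *: v) = a ^+ 2 * qform A v.
Proof.
by rewrite /qform -!scalemxAl linearZ /= -scalemxAr !mxE mulrA -expr2.
Qed.

Lemma qformD A (u v : V) : qform A (u + v) = qform A u + qform A v + polar A u v.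
Proof. by rewrite /polar; ring. Qed.

Lemma polarC A (u v : V) : polar A u v = polar A v u.
Proof. by rewrite /polar [v + u]addrC; ring. Qed.

(** Perpendicularity to u is membership in the hyperplane of the functional
    u times (A + A^T). *)
Lemma polar_dot A (u v : V) : polar A u v = dot v (u *m (A + A^T)).
Proof.
have mxD (M N : 'M[F]_1) : (M + N) 0 0 = M 0 0 + N 0 0 by rewrite mxE.
have tr : (u *m A^T *m v^T) 0 0 = (v *m A *m u^T) 0 0.
  by rewrite -[in RHS](trmxK (v *m A *m u^T)) [in RHS]mxE !trmx_mul !trmxK mulmxA.
rewrite dotC /polar /dot /qform linearD /= !(mulmxDl, mulmxDr) !mxD tr.
ring.
Qed.

Lemma qform0 A : qform A (0 : V) = 0.
Proof. by rewrite -(scale0r 0) qformZ expr0n mul0r. Qed.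

Lemma totally_singularP A (W : {vspace V}) :
  reflect (forall v, v \in W -> qform A v = 0) (totally_singular A W).
Proof.
rewrite /totally_singular; apply: (iffP forallP) => hW v.
  by move=> vW; apply/eqP; move/implyP: (hW v); apply.
by apply/implyP => /hW ->.
Qed.

Lemma totally_singular_line A (v : V) : totally_singular A <[v]>%VS = (qform A v == 0).
Proof.
apply/totally_singularP/eqP => [h|h u /vlineP[a ->]]; first exact/h/memv_line.
by rewrite qformZ h mulr0.
Qed.

Definition pt (v : V) (v0 : v != 0) : point F :=
  Sub <[v]>%VS (introT eqP (etrans (dim_vline v) (congr1 nat_of_bool v0))).

Lemma pointP (P : point F) : exists v (v0 : v != 0), P = pt v0.
Proof.
have [v v0 vP] : exists2 v, v != 0 & val P = <[v]>%VS.
  exists (vpick (val P)); first by rewrite vpick0 -dimv_eq0 (eqP (valP P)).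
  apply/esym/eqP; rewrite eqEdim -memvE memv_pick (eqP (valP P)) dim_vline.
  by rewrite vpick0 -dimv_eq0 (eqP (valP P)).
by exists v, v0; apply: val_inj.
Qed.

Lemma mem_quadric A (U : {vspace V}) v (v0 : v != 0) :
  (pt v0 \in quadric_points A U) = (v \in U) && (qform A v == 0).
Proof. by rewrite inE /= -memvE totally_singular_line. Qed.

End Forms.

(** * From a perpendicularity relation to a quadratic form *)

Section Perp.

Variables (F : finFieldType) (char2 : 2%N \in [pchar F]).
Local Notation V := 'rV[F]_5.

Lemma sqrD2 (x y : F) : (x + y) ^+ 2 = x ^+ 2 + y ^+ 2.
Proof. by rewrite sqrrD mulr2n (addrr_pchar2 char2) addr0. Qed.

Lemma addvv (v : V) : v + v = 0.
Proof. by rewrite -mulr2n -scaler_nat (pcharf0 char2) scale0r. Qed.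

Lemma sqrt2 (x : F) : exists y, y ^+ 2 = x.
Proof.
have [k hk] : exists k, #|F| = (k * 2)%N.
  exists (#|F| %/ 2)%N; apply/esym/eqP; rewrite -dvdn_eq.
  have := card_pprimeChar char2; case: (logn _ _) => [|m] h.
    by have := card_gt1 F; rewrite [#|F|]h.
  by rewrite [#|F|]h expnS dvdn_mulr.
by exists (x ^+ k); rewrite -exprM -hk expf_card.
Qed.

Variables (phi : V -> F) (n : V).
Hypothesis phiZ : forall a v, phi (a *: v) = a * phi v.
Hypothesis phi_shift : forall v t, phi (v + t *: n) = phi v + t.

(** If phi ^+ 2 is a quadratic form in characteristic 2, its polar form vanishes
    at (u, v) exactly when phi is additive there. The hypotheses below say that
    this relation behaves like the perpendicularity of a symplectic form with
    radical <n>. *)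
Definition perp u v := phi (u + v) = phi u + phi v.

Hypothesis perpZr : forall a u v, perp u v -> perp u (a *: v).
Hypothesis perpDr : forall u v w, perp u v -> perp u w -> perp u (v + w).
(** The perp of u meets every 2-dimensional subspace, hence has
    codimension at most 1. *)
Hypothesis perp_comb : forall u v w, exists x y : F,
  ((x != 0) || (y != 0)) /\ perp u (x *: v + y *: w).
Hypothesis perp_nondeg : forall u, (forall v, perp u v) -> exists t, u = t *: n.

Lemma perpC u v : perp u v -> perp v u.
Proof. by rewrite /perp addrC => ->; rewrite addrC. Qed.

Lemma phi0 : phi 0 = 0.
Proof. by rewrite -(scale0r 0) phiZ mul0r. Qed.

Lemma perpvv u : perp u u.
Proof. by rewrite /perp addvv phi0 (addrr_pchar2 char2). Qed.

Lemma phin t : phi (t *: n) = t.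
Proof. by rewrite -[_ *: _]add0r phi_shift phi0 add0r. Qed.

Lemma perpn u t : perp u (t *: n).
Proof. by rewrite /perp phi_shift phin. Qed.

Lemma perpZl a u v : perp u v -> perp (a *: u) v.
Proof. by move=> /perpC/(perpZr a)/perpC. Qed.

Lemma perpDl u v w : perp u w -> perp v w -> perp (u + v) w.
Proof. by move=> /perpC uw /perpC vw; apply/perpC/perpDr. Qed.

Lemma perp_cancel u v w : perp u v -> perp u (v + w) -> perp u w.
Proof.
by move=> uv uvw; have := perpDr uv uvw; rewrite addrA addvv add0r.
Qed.

Lemma perp_scaled u v a : perp u (a *: v) -> ~ perp u v -> a = 0.
Proof.
move=> h nuv; apply/eqP/negPn/negP => a0; apply: nuv.
by have := perpZr a^-1 h; rewrite scalerA mulVf // scale1r.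
Qed.

Lemma perp_adjust u v w : ~ perp u w -> exists y, perp u (v + y *: w).
Proof.
move=> nuw; have [x [y [xy0 h]]] := perp_comb u v w.
have [x0|x0] := eqVneq x 0.
  move: xy0 h; rewrite x0 eqxx scale0r add0r /= => y0 /perp_scaled/(_ nuw) yE.
  by rewrite yE eqxx in y0.
exists (x^-1 * y); have := perpZr x^-1 h.
by rewrite scalerDr !scalerA mulVf // scale1r.
Qed.

Lemma perpP u v : reflect (perp u v) (phi (u + v) == phi u + phi v).
Proof. exact: eqP. Qed.

Lemma nperp_exists u : u \notin <[n]>%VS -> exists v, ~ perp u v.
Proof.
move=> un; have [/existsP[v /perpP nv]|] :=
  boolP [exists v, phi (u + v) != phi u + phi v]; first by exists v.
rewrite negb_exists => /forallP h; case/negP: un.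
have [v|t ->] := @perp_nondeg u; last by rewrite memvZ ?memv_line.
by apply/perpP; have := h v; rewrite negbK.
Qed.

Lemma perp_adjust2 e f v : ~ perp e f -> exists x y,
  perp e (v + x *: e + y *: f) /\ perp f (v + x *: e + y *: f).
Proof.
move=> nef.
have [y hy] := perp_adjust v nef.
have nfe : ~ perp f e by move/perpC.
have [x hx] := perp_adjust v nfe.
exists x, y; split.
  rewrite addrAC; apply: perpDr => //; exact/perpZr/perpvv.
by apply: perpDr => //; apply/perpZr/perpvv.
Qed.

Lemma dim_span3 (a b c : V) : (\dim <<[:: a; b; c]>> <= 3)%N.
Proof. by have := dim_span [:: a; b; c]. Qed.

Lemma exists_outside (X Y : {vspace V}) : (\dim Y < \dim X)%N ->
  exists2 v, v \in X & v \notin Y.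
Proof.
move=> dYX; have /subvPn[v vX vY] : ~~ (X <= Y)%VS.
  by apply: contraL dYX => /dimvS; rewrite -leqNgt.
by exists v.
Qed.

(** Gram-Schmidt: a vector outside <n> has a non-perpendicular partner, and any
    further vector can be corrected by this pair to be perpendicular to both. *)
Lemma symplectic_basis : exists e1 f1 e2 f2,
  [/\ ~ perp e1 f1, ~ perp e2 f2,
      perp e1 e2 /\ perp e1 f2 & perp f1 e2 /\ perp f1 f2].
Proof.
have [e1 _ e1n] : exists2 v : V, v \in fullv & v \notin <[n]>%VS.
  by apply: exists_outside; rewrite dimvf /dim /= dim_vline; case: (n != 0).
have [f1 ef1] := nperp_exists e1n.
have [g _ gn] : exists2 v : V, v \in fullv & v \notin <<[:: n; e1; f1]>>%VS.
  apply: exists_outside; rewrite dimvf /dim /=.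
  by apply: leq_ltn_trans (dim_span3 _ _ _) _.
have [x [y [he hf]]] := perp_adjust2 g ef1.
set e2 := g + _ + _ in he hf.
have e2n : e2 \notin <[n]>%VS.
  apply: contra gn => h.
  have -> : g = e2 - y *: f1 - x *: e1 by rewrite /e2 !addrK.
  have mem3 v : v \in [:: n; e1; f1] -> v \in <<[:: n; e1; f1]>>%VS.
    exact: memv_span.
  rewrite !memvB ?memvZ ?(mem3 e1) ?(mem3 f1) ?inE ?eqxx ?orbT //.
  have /subvP sub : (<[n]> <= <<[:: n; e1; f1]>>)%VS.
    by rewrite -memvE memv_span ?inE ?eqxx.
  exact: sub.
have [g2 eg2] := nperp_exists e2n.
have [x' [y' [he' hf']]] := perp_adjust2 g2 ef1.
exists e1, f1, e2, (g2 + x' *: e1 + y' *: f1); split => // h; apply: eg2.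
apply: (@perp_cancel _ (x' *: e1 + y' *: f1)).
  by apply/perpDr; apply/perpZr/perpC.
by rewrite addrC addrA.
Qed.

(** Each e1 + c e2 is perpendicular to some m(c) f1 + f2, and each e1 + d f2 to
    some k(d) f1 + e2. The vector x = e1 + c e2 + d f2 is perpendicular to both
    of these, to e1 and to itself, so d m(c) + c k(d) must vanish because f1 is
    not perpendicular to x. After scaling f2 so that m(1) = 1, the case d = 1
    gives m(c) = c: the perpendicularity relation is that of the standard
    symplectic form on these vectors. *)
Lemma symplectic_diagonal e1 f1 e2 f2 :
  ~ perp e1 f1 -> ~ perp e2 f2 -> perp e1 e2 -> perp e1 f2 -> perp f1 e2 ->
  perp f1 f2 -> exists2 l, l != 0 &
  forall c, perp (e1 + c *: e2) (c *: f1 + l *: f2).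
Proof.
move=> h1 h2 e12 ef12 fe12 f12.
have aux e f e' f' : ~ perp e f -> perp e e' -> perp e f' -> perp f e' ->
    perp f f' -> forall c, exists m, perp (e + c *: e') (m *: f + f').
  move=> nef ee ef' fe' ff' c.
  have [|m hm] := @perp_adjust (e + c *: e') f' f.
    move=> /perpC h; apply: nef; apply/perpC; move: h; rewrite addrC.
    by apply: perp_cancel; exact: perpZr.
  by exists m; rewrite [m *: f + _]addrC.
have [m1] := aux e1 f1 e2 f2 h1 e12 ef12 fe12 f12 1.
rewrite scale1r => hm1.
have m1n0 : m1 != 0.
  apply/eqP => m0; rewrite m0 scale0r add0r in hm1; apply: h2; apply/perpC.
  by apply: perp_cancel (perpC hm1); apply/perpC.
exists m1^-1; first by rewrite invr_eq0.
have h12 : perp (e1 + e2) (f1 + m1^-1 *: f2).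
  by have := perpZr m1^-1 hm1; rewrite scalerDr scalerA mulVf // scale1r.
set f2' := m1^-1 *: f2 in h12 *.
have ef12' : perp e1 f2' by apply: perpZr.
have f12' : perp f1 f2' by apply: perpZr.
have step c m k : perp (e1 + c *: e2) (m *: f1 + f2') ->
    perp (e1 + f2') (k *: f1 + e2) -> m = c * k.
  move=> hm hk; set x := e1 + (c *: e2 + f2').
  have xf1 : ~ perp x f1.
    move=> /perpC; rewrite /x addrC => h; apply: h1; apply/perpC.
    by apply: perp_cancel h; apply: perpDr => //; apply: perpZr.
  have xv : perp x (m *: f1 + f2').
    rewrite /x addrA; apply: perpDl => //; apply: perpDr; last exact: perpvv.
    exact/perpZr/perpC.
  have xv' : perp x (k *: f1 + e2).
    rewrite /x addrCA; apply: perpDl => //; apply/perpZl/perpDr; last exact: perpvv.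
    exact/perpZr/perpC.
  have xx : perp x (c *: e2 + f2').
    apply: (@perp_cancel _ e1); last exact: perpvv.
    by apply/perpC; apply: perpDr; [exact: perpvv | apply: perpDr => //; exact: perpZr].
  have := perpDr (perpDr xv (perpZr c xv')) xx.
  rewrite (_ : _ + _ + _ = (m + c * k) *: f1).
    by move/perp_scaled/(_ xf1)/eqP; rewrite addr_eq0 (oppr_pchar2 char2) => /eqP.
  rewrite scalerDr scalerA scalerDl -!addrA; congr (_ + _).
  by rewrite addrC -!addrA !addvv !addr0 addvv addr0.
have e1e2 : perp (e1 + 1 *: e2) (1 *: f1 + f2') by rewrite !scale1r.
have [k] := aux e1 f1 f2' e2 h1 ef12' e12 f12' fe12 1.
rewrite scale1r => hk.
have k1 := step _ _ _ e1e2 hk; rewrite mul1r in k1.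
move=> c; have [m hm] := aux e1 f1 e2 f2' h1 e12 ef12' fe12 f12' c.
by have mE := step _ _ _ hm hk; rewrite mE -k1 mulr1 in hm.
Qed.

Section Normalised.

Variables e1 f1 e2 f2 : V.
Hypotheses (nef1 : ~ perp e1 f1) (nef2 : ~ perp e2 f2)
  (ee : perp e1 e2) (ef : perp e1 f2) (fe : perp f1 e2) (ff : perp f1 f2)
  (diag : forall c, perp (e1 + c *: e2) (c *: f1 + f2)).

(** The deviation of phi from linearity on the hyperbolic line <e, f>, in the
    inhomogeneous coordinate x. *)
Definition defect e f x := phi (e + x *: f) - phi e - x * phi f.

Lemma phi_pair e f a b : a != 0 ->
  phi (a *: e + b *: f) = a * phi e + b * phi f + a * defect e f (b / a).
Proof.
move=> a0; rewrite /defect.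
have -> : a *: e + b *: f = a *: (e + (b / a) *: f).
  by rewrite scalerDr scalerA mulrCA divff // mulr1.
by rewrite phiZ; field.
Qed.

Lemma cross a b c d : perp (a *: e1 + b *: f1) (c *: e2 + d *: f2).
Proof.
by apply: perpDl; apply: perpDr; apply/perpZl/perpZr.
Qed.

(** The vector e1 + c e2 + c d f1 + d f2 is a sum of perpendicular vectors in two
    ways: one groups it along the diagonal, where phi is additive on all four
    terms, the other along the two hyperbolic lines. *)
Lemma defect_mul c d : c != 0 ->
  defect e1 f1 (c * d) = - c * defect e2 f2 (d / c).
Proof.
move=> c0.
have h1 : phi (e1 + c *: e2 + (d * c) *: f1 + d *: f2) =
    phi e1 + c * phi e2 + d * c * phi f1 + d * phi f2.
  have : perp (e1 + c *: e2) ((d * c) *: f1 + d *: f2).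
    by rewrite -scalerA -scalerDr; apply/perpZr/diag.
  rewrite /perp addrA => ->.
  have -> := perpZr c ee; have -> : perp ((d * c) *: f1) (d *: f2).
    exact/perpZl/perpZr.
  by rewrite !phiZ addrA.
have h2 : phi (e1 + c *: e2 + (d * c) *: f1 + d *: f2) =
    phi (e1 + (c * d) *: f1) + phi (c *: e2 + d *: f2).
  rewrite -[e1 in RHS]scale1r -cross scale1r (mulrC c d) addrA.
  by congr (phi (_ + _)); rewrite addrAC.
move: h1; rewrite h2 phi_pair // /defect.
set P := phi (e1 + _); set R := phi (e2 + _) => /eqP; rewrite -subr_eq0 => /eqP h.
apply/eqP; rewrite -subr_eq0; apply/eqP; rewrite -[RHS]h; ring.
Qed.

Definition kappa := defect e1 f1 1 ^+ 2.

(** With d = c, the preceding identity reads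
    defect (c^2) = c * defect 1, where the two defects at 1 agree up to sign by
    the case c = d = 1; and every x is a square. *)
Lemma defect1 x : defect e1 f1 x ^+ 2 = x * kappa.
Proof.
have [y <-] := sqrt2 x.
have d12 : defect e1 f1 1 = - defect e2 f2 1.
  by have := @defect_mul 1 1 (oner_neq0 _); rewrite mul1r divr1 mulN1r.
have [->|y0] := eqVneq y 0.
  by rewrite expr0n /= mul0r /defect scale0r addr0 mul0r subr0 subrr expr0n.
have -> : defect e1 f1 (y ^+ 2) = y * defect e1 f1 1.
  by rewrite expr2 defect_mul // divff // mulNr -mulrN -d12.
by rewrite exprMn.
Qed.

Lemma defect2 x : defect e2 f2 x ^+ 2 = x * kappa.
Proof.
rewrite -defect1; have := @defect_mul 1 x (oner_neq0 _).
by rewrite mul1r divr1 mulN1r => ->; rewrite sqrrN.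
Qed.

Lemma phi_pair_sq e f a b : (forall x, defect e f x ^+ 2 = x * kappa) ->
  phi (a *: e + b *: f) ^+ 2 =
    a ^+ 2 * phi e ^+ 2 + b ^+ 2 * phi f ^+ 2 + kappa * (a * b).
Proof.
move=> hd; have [->|a0] := eqVneq a 0.
  by rewrite scale0r add0r phiZ exprMn; ring.
by rewrite phi_pair // !sqrD2 !exprMn hd; field.
Qed.

Lemma phi_sq x0 x1 x2 x3 x4 :
  phi (x0 *: n + x1 *: e1 + x2 *: f1 + x3 *: e2 + x4 *: f2) ^+ 2 =
  x0 ^+ 2 + x1 ^+ 2 * phi e1 ^+ 2 + x2 ^+ 2 * phi f1 ^+ 2
  + x3 ^+ 2 * phi e2 ^+ 2 + x4 ^+ 2 * phi f2 ^+ 2 + kappa * (x1 * x2 + x3 * x4).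
Proof.
rewrite -!addrA [_ *: n + _]addrC phi_shift addrA cross !sqrD2.
rewrite (phi_pair_sq _ _ defect1) (phi_pair_sq _ _ defect2); ring.
Qed.

Definition frame : 'M[F]_5 := \matrix_(i < 5) nth 0 [:: n; e1; f1; e2; f2] i.

Lemma mul_frame (x : V) : x *m frame =
  x 0 0 *: n + x 0 1 *: e1 + x 0 2%:R *: f1 + x 0 3%:R *: e2 + x 0 4%:R *: f2.
Proof.
rewrite mulmx_sum_row !big_ord_recr big_ord0 /= add0r.
by rewrite !rowK /=; do !congr (_ + _); congr (x 0 _ *: _); apply: val_inj.
Qed.

Lemma perp0 u : perp u 0.
Proof. by rewrite -(scale0r n); apply: perpn. Qed.

(** Perpendicularity to one member of a hyperbolic pair kills the coordinate of
    the other; this makes the frame a basis. *)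
Lemma perp_coord x0 x1 x2 x3 x4 :
  let v := x0 *: n + x1 *: e1 + x2 *: f1 + x3 *: e2 + x4 *: f2 in
  [/\ perp f1 v -> x1 = 0, perp e1 v -> x2 = 0,
      perp f2 v -> x3 = 0 & perp e2 v -> x4 = 0].
Proof.
have [[ee' ef'] [fe' ff']] := ((perpC ee, perpC ef), (perpC fe, perpC ff)).
have perp_mul u a b : perp u b \/ u = b -> perp u (a *: b).
  by case=> [h|->]; apply: perpZr => //; exact: perpvv.
split.
- rewrite (+%R.[ACl 1*3*4*5*2])=> h.
  apply: (@perp_scaled f1 e1); last by move/perpC.
  apply: (perp_cancel _ h); do 3 (apply: perpDr; last by apply: perp_mul; auto).
  exact: perpn.
- rewrite (+%R.[ACl 1*2*4*5*3])=> h; apply: (@perp_scaled e1 f1) => //.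
  apply: (perp_cancel _ h); do 3 (apply: perpDr; last by apply: perp_mul; auto).
  exact: perpn.
- rewrite (+%R.[ACl 1*2*3*5*4])=> h.
  apply: (@perp_scaled f2 e2); last by move/perpC.
  apply: (perp_cancel _ h); do 3 (apply: perpDr; last by apply: perp_mul; auto).
  exact: perpn.
move=> h; apply: (@perp_scaled e2 f2) => //.
apply: (perp_cancel _ h); do 3 (apply: perpDr; last by apply: perp_mul; auto).
exact: perpn.
Qed.

Lemma frame_unit : frame \in unitmx.
Proof.
rewrite -row_free_unit; apply: inj_row_free => x.
rewrite mul_frame; have := perp_coord (x 0 0) (x 0 1) (x 0 2%:R) (x 0 3%:R) (x 0 4%:R).
rewrite /=; set v := (_ + _); move=> [c1 c2 c3 c4] v0.
have zero u : perp u v by rewrite v0; apply: perp0.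
move: v0; rewrite /v c1 // c2 // c3 // c4 // !scale0r !addr0 => n0.
have x0 : x 0 0 = 0 by rewrite -(phin (x 0 0)) n0 phi0.
apply/rowP => i; rewrite mxE; case: i => -[|[|[|[|[|//]]]]] p.
- by rewrite -x0; congr (x 0 _); apply: val_inj.
- by rewrite -(c1 (zero _)); congr (x 0 _); apply: val_inj.
- by rewrite -(c2 (zero _)); congr (x 0 _); apply: val_inj.
- by rewrite -(c3 (zero _)); congr (x 0 _); apply: val_inj.
by rewrite -(c4 (zero _)); congr (x 0 _); apply: val_inj.
Qed.

Lemma phi_sq_qform : exists A, forall v, qform A v = phi v ^+ 2.
Proof.
(* The form x0^2 + sum phi(e)^2 x_e^2 + kappa (x1 x2 + x3 x4) of phi_sq. *)
pose d : 'rV[F]_5 := \row_(i < 5) (phi (nth 0 [:: n; e1; f1; e2; f2] i) ^+ 2).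
pose G : 'M[F]_5 :=
  diag_mx d + kappa *: (delta_mx 1 2%:R + delta_mx 3%:R 4%:R).
exists (invmx frame *m G *m (invmx frame)^T) => v.
pose x := v *m invmx frame.
have -> : qform (invmx frame *m G *m (invmx frame)^T) v = qform G x.
  by rewrite /qform /x trmx_mul !mulmxA.
have -> : v = x *m frame by rewrite mulmxKV // frame_unit.
rewrite mul_frame phi_sq.
have qE (B : 'M[F]_5) : qform B x = \sum_i \sum_j x 0 i * B i j * x 0 j.
  rewrite /qform mxE exchange_big /=; apply: eq_bigr => j _.
  by rewrite !mxE mulr_suml.
have phin1 : phi n = 1 by rewrite -(phin 1) scale1r.
(* All indices are brought to the form inord k, so that Kronecker deltas
   compute. *)
have o (k : nat) (i : 'I_5) : i = k :> nat -> i = inord k.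
  by move=> ik; apply: ord_inj; rewrite inordK // -ik.
rewrite qE; clearbody x; rewrite !big_ord_recr !big_ord0 /=.
rewrite !add0r (@o 0 (widen_ord _ _)) // (@o 1 (widen_ord _ _)) //.
rewrite (@o 2 (widen_ord _ _)) // (@o 3 (widen_ord _ _)) // (@o 4 ord_max) //.
rewrite /G (@o 4 4%:R) // (@o 3 3%:R) // (@o 2 2%:R) // (@o 1 1) // (@o 0 0) //.
have E i j : (i < 5)%N -> (j < 5)%N -> (inord i == inord j :> 'I_5) = (i == j).
  move=> hi hj; apply/eqP/eqP => [/(congr1 (@nat_of_ord 5))|-> //].
  by rewrite !inordK.
rewrite !mxE !E // !inordK //=.
rewrite !mulr1n !mulr0n phin1; ring.
Qed.

End Normalised.

Lemma perp_quadratic : exists A, forall v, qform A v = phi v ^+ 2.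
Proof.
have [e1 [f1 [e2 [f2 [nef1 nef2 [ee ef] [fe ff]]]]]] := symplectic_basis.
have [l l0 diag] := symplectic_diagonal nef1 nef2 ee ef fe ff.
apply: (@phi_sq_qform e1 f1 e2 (l *: f2)) => //; try exact: perpZr.
by move=> h; apply: nef2; have := perpZr l^-1 h; rewrite scalerA mulVf ?scale1r.
Qed.

(** The perpendicularity relation is alternating, so its radical on S has the
    parity of \dim S and is larger than <n>: take u outside <n>, a partner v if
    u is not itself in the radical, and correct a fourth vector to be
    perpendicular to u and v. *)
Lemma perp_radical (S : {vspace V}) : \dim S = 4%N -> n \in S ->
  exists p, [/\ p \in S, p != 0, phi p = 0 & forall s, s \in S -> perp p s].
Proof.
move=> dS nS.
suff [p [pS pn hp]] : exists p, [/\ p \in S, p \notin <[n]>%VS &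
    forall s, s \in S -> perp p s].
  exists (p + (- phi p) *: n); split.
  - by rewrite memvD ?memvZ.
  - apply: contra pn; rewrite scaleNr subr_eq0 => /eqP ->.
    by rewrite memvZ ?memv_line.
  - by rewrite phi_shift subrr.
  by move=> s sS; apply: perpDl; [exact: hp | apply/perpC/perpn].
have [u uS un] : exists2 v : V, v \in S & v \notin <[n]>%VS.
  by apply: exists_outside; rewrite dS dim_vline; case: (n != 0).
have [/forallP uperp|] := boolP [forall v in S, phi (u + v) == phi u + phi v].
  exists u; split=> // s sS; apply/perpP; exact: (implyP (uperp s)).
rewrite negb_forall => /existsP[v]; rewrite negb_imply => /andP[vS /perpP nuv].
have [g gS gn] : exists2 w : V, w \in S & w \notin <<[:: n; u; v]>>%VS.
  by apply: exists_outside; rewrite dS; apply: leq_ltn_trans (dim_span3 _ _ _) _.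
have [x [y [hu hv]]] := perp_adjust2 g nuv.
set w := g + _ + _ in hu hv.
have mem3 t : t \in [:: n; u; v] -> t \in <<[:: n; u; v]>>%VS.
  exact: memv_span.
have wn : w \notin <<[:: n; u; v]>>%VS.
  apply: contra gn => h.
  have -> : g = w - y *: v - x *: u by rewrite /w !addrK.
  by rewrite !memvB ?memvZ ?(mem3 u) ?(mem3 v) ?inE ?eqxx ?orbT.
have wS : w \in S by rewrite /w !memvD ?memvZ.
have fr : free [:: w; u; v; n].
  have vn : v \notin <[n]>%VS.
    by apply/negP => /vlineP[t vE]; apply: nuv; rewrite vE; apply: perpn.
  rewrite !free_cons !span_cons span_nil addv0 nil_free andbT.
  apply/and4P; split.
  - apply: contra wn; rewrite !span_cons span_nil addv0.
    by rewrite addvA addvC.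
  - apply/negP => /memv_addP[_ /vlineP[a ->] [_ /vlineP[t ->] uE]].
    apply: nuv; rewrite uE; apply: perpDl; first exact/perpZl/perpvv.
    exact/perpC/perpn.
  - exact: vn.
  rewrite memv0; apply/eqP => n0.
  by have := phin 1; rewrite n0 scaler0 phi0 => /esym/eqP; rewrite oner_eq0.
exists w; split=> //.
  apply: contra wn; apply/subvP; rewrite -memvE; apply: mem3.
  by rewrite inE eqxx.
move=> s sS; have : s \in <<[:: w; u; v; n]>>%VS.
  rewrite (_ : <<_>>%VS = S) //; apply/eqP; rewrite eqEdim dS.
  rewrite (eqP fr) leqnn andbT; apply/span_subvP => t.
  by rewrite !inE => /or4P[] /eqP ->.
rewrite !span_cons span_nil addv0.
move=> /memv_addP[_ /vlineP[a ->] [_ /memv_addP[_ /vlineP[b ->]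
  [_ /memv_addP[_ /vlineP[c ->] [_ /vlineP[d ->] ->]] ->]] ->]].
apply: perpDr; first exact/perpZr/perpvv.
apply: perpDr; first exact/perpZr/perpC.
apply: perpDr; first exact/perpZr/perpC.
exact: perpn.
Qed.

End Perp.

(** * Sets with the intersection numbers of a parabolic quadric *)

Section QuadraticSet.

Variables (F : finFieldType) (char2 : 2%N \in [pchar F]).
Local Notation V := 'rV[F]_5.
Local Notation q := #|F|.

(** Z is the cone of vectors of a point set, with 0: a set of a points in a
    subspace contributes 1 + a (q - 1) vectors. So line_cases allows 0, 1, 2 or
    q + 1 points on a line off n, and dvdn_plane says that planes have 1 mod q
    points. *)
Variables (Z : {set V}) (n : V).
Local Notation z X := #|[predI X & Z]|.

Hypothesis Z0 : 0 \in Z.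
Hypothesis ZZE : forall a v, a != 0 -> (a *: v \in Z) = (v \in Z).
Hypothesis nZ : n \notin Z.
Hypothesis dvdn_plane : forall E : {vspace V}, \dim E = 3%N -> (q %| z E)%N.
Hypothesis line_cases : forall l : {vspace V}, \dim l = 2%N -> n \notin l ->
  (z l < 2 * q)%N \/ z l = (q ^ 2)%N.
Hypothesis line_on_n : forall l : {vspace V}, \dim l = 2%N -> n \in l -> z l = q.
Hypothesis secant_exists : forall p, p \in Z -> p != 0 ->
  exists v, [/\ v \in Z, v \notin <[p]>%VS & (z (<[p]> + <[v]>)%VS < 2 * q)%N].

Lemma ZZ a v : v \in Z -> a *: v \in Z.
Proof. by have [->|a0] := eqVneq a 0; rewrite ?scale0r // ZZE. Qed.

Lemma scaled_mem (X : {vspace V}) a v : a != 0 -> (a *: v \in X) = (v \in X).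
Proof.
move=> a0; apply/idP/idP => [|h]; last exact: memvZ.
by move=> /(memvZ a^-1); rewrite scalerA mulVf // scale1r.
Qed.

(** Each vector of L + <u> outside L is uniquely x (u + l) with x nonzero, and Z
    is invariant under x. *)
Lemma card_extend (L : {vspace V}) u : u \notin L ->
  z (L + <[u]>)%VS = (z L + q.-1 * #|[pred l in L | (u + l)%R \in Z]|)%N.
Proof.
move=> uL; rewrite -(cardID L [predI (L + <[u]>)%VS & Z]); congr (_ + _)%N.
  apply: eq_card => v.
  rewrite -[LHS]/(((v \in (L + <[u]>)%VS) && (v \in Z)) && (v \in L)).
  rewrite -[RHS]/((v \in L) && (v \in Z)) andbC.
  by case: (boolP (v \in L)) => //= vL; rewrite (subvP (addvSl _ _)).
pose f (xl : F * V) := xl.1 *: (u + xl.2).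
have inj : {in [predX predC1 0 & [pred l in L | (u + l)%R \in Z]] &, injective f}.
  move=> [x l] [y k]; rewrite !inE /= /f /=.
  move=> /andP[x0 /andP[lL _]] /andP[y0 /andP[kL _]] E.
  have xy : x = y.
    apply/eqP; rewrite -subr_eq0; apply: contraNT uL => d0.
    rewrite -(scaled_mem _ _ d0) scalerBl.
    have -> : x *: u - y *: u = y *: k - x *: l.
      apply/eqP; rewrite subr_eq eq_sym addrAC subr_eq -!scalerDr E.
      by rewrite [k + u]addrC.
    by rewrite memvB ?memvZ.
  by move: E; rewrite xy => /(scalerI y0)/addrI ->.
have -> : q.-1 = #|predC1 (0 : F)| by rewrite cardC1.
rewrite -cardX -(card_in_image inj); apply: eq_card => v.
apply/idP/imageP => [|[[x l]]].
  rewrite !inE -!/(_ \in Z) => /andP[vL /andP[/memv_addP[l lL [_ /vlineP[x ->] vE]] vZ]].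
  have x0 : x != 0 by apply: contraNneq vL => x0; rewrite vE x0 scale0r addr0.
  exists (x, x^-1 *: l); last by rewrite /f /= scalerDr scalerA mulfV // scale1r addrC.
  rewrite !inE /= x0 memvZ //= -(ZZE _ x0) scalerDr scalerA mulfV // scale1r addrC.
  by rewrite -vE.
rewrite !inE -!/(_ \in Z) /= /f => /and3P[x0 lL uZ] ->.
rewrite /= scaled_mem // ZZE // uZ andbT; apply/andP; split.
  by apply: contra uL => h; rewrite -[u](addrK l) memvB.
by rewrite memvZ // addrC memv_add ?memv_line.
Qed.

Section Tangent.

Variable p : V.
Hypotheses (pZ : p \in Z) (p0 : p != 0).

(** For v outside <p>, the number of points of Z other than <p> on the line
    joining <p> and <v>. *)
Definition sect v := #|[pred l in <[p]>%VS | (v + l)%R \in Z]|.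
(** The line joining <p> and <v> is not a 2-secant, or v is in <p>. *)
Definition tangent v := sect v != 1%N.

Lemma line_sub l : l \in <[p]>%VS -> l \in Z.
Proof. by move=> /vlineP[a ->]; apply: ZZ. Qed.

Lemma card_line : #|<[p]>%VS| = q.
Proof. by rewrite cardv dim_vline p0 expn1. Qed.

Lemma sect_line v : v \in <[p]>%VS -> sect v = q.
Proof.
move=> vp; rewrite -card_line; apply: eq_card => l.
rewrite -[LHS]/((l \in <[p]>%VS) && ((v + l)%R \in Z)) andb_idr // => lp.
by apply: line_sub; rewrite memvD.
Qed.

Lemma sectZ a v : a != 0 -> sect (a *: v) = sect v.
Proof.
move=> a0; rewrite /sect -[in RHS](card_image (scalerI a0)); apply: eq_card => l.
apply/idP/imageP => [/andP[lp lZ]|[k /andP[/= kp kZ] ->]].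
  exists (a^-1 *: l); last by rewrite scalerA mulfV // scale1r.
  apply/andP; split; first exact: memvZ.
  by rewrite /= -(ZZE _ a0) scalerDr scalerA mulfV // scale1r.
by apply/andP; split; [exact: memvZ | rewrite /= -scalerDr ZZE].
Qed.

Lemma sectD v k : k \in <[p]>%VS -> sect (v + k) = sect v.
Proof.
move=> kp; rewrite /sect -(card_image (addrI k)); apply: eq_card => l.
apply/imageP/idP => [[j /andP[/= jp jZ] ->]|/andP[/= lp lZ]].
  by apply/andP; split; [exact: memvD | rewrite /= addrA].
exists (l - k); last by rewrite addrC subrK.
by apply/andP; split; [exact: memvB | rewrite /= -addrA [k + _]addrC subrK].
Qed.

Lemma z_line : z <[p]>%VS = q.
Proof.
rewrite -card_line; apply: eq_card => l.
rewrite -[LHS]/((l \in <[p]>%VS) && (l \in Z)) andb_idr //; exact: line_sub.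
Qed.

Lemma z_sect v : v \notin <[p]>%VS ->
  z (<[p]> + <[v]>)%VS = (q + q.-1 * sect v)%N.
Proof. by move=> vp; rewrite card_extend // z_line. Qed.

Lemma sect_cases v : [\/ sect v = 0%N, sect v = 1%N | sect v = q].
Proof.
have q1 := card_gt1 F.
have [vp|vp] := boolP (v \in <[p]>%VS); first by constructor 3; apply: sect_line.
have dl : \dim (<[p]> + <[v]>)%VS = 2%N by rewrite dim_add_line // dim_vline p0.
have := z_sect vp; have [nl|nl] := boolP (n \in (<[p]> + <[v]>)%VS).
  rewrite line_on_n // => /eqP; rewrite -[X in X == _]addn0 eqn_add2l eq_sym.
  rewrite muln_eq0 => /orP[|/eqP]; last by constructor 1.
  by move: q1; clear; lia.
case: (line_cases dl nl) => zE zE'; rewrite zE' in zE.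
  have : (q.-1 * sect v < q.-1 * 2)%N by move: zE q1; clear; lia.
  rewrite ltn_pmul2l; last by move: q1; clear; lia.
  by case: (sect v) => [|[|//]] _; [constructor 1|constructor 2].
constructor 3; apply/eqP; rewrite -(@eqn_pmul2l q.-1); last by move: q1; clear; lia.
by apply/eqP; move: zE q1; clear; nia.
Qed.

(** Sorts the vectors of <p> + <v> by their coordinate y along v. *)
Lemma card_extend_sect v u : v \notin <[p]>%VS ->
  #|[pred l in (<[p]> + <[v]>)%VS | (u + l)%R \in Z]| = (\sum_y sect (u + y *: v))%N.
Proof.
move=> vp; pose f (yl : F * V) := yl.1 *: v + yl.2.
pose A := [pred yl : F * V | (yl.2 \in <[p]>%VS) && ((u + yl.1 *: v + yl.2)%R \in Z)].
have inj : {in A &, injective f}.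
  move=> [x l] [y k] /andP[/= lp _] /andP[/= kp _]; rewrite /f /= => E.
  have xy : x = y.
    apply/eqP; rewrite -subr_eq0; apply: contraNT vp => d0.
    rewrite -(scaled_mem _ _ d0) scalerBl.
    have -> : x *: v - y *: v = k - l.
      by apply/eqP; rewrite subr_eq eq_sym addrAC subr_eq E addrC.
    exact: memvB.
  by move: E; rewrite xy => /addrI ->.
transitivity #|A|.
  rewrite -(card_in_image inj); apply: eq_card => l; apply/idP/imageP.
    move=> /andP[/= /memv_addP[k kp [_ /vlineP[y ->] ->]] lZ].
    exists (y, k); last by rewrite /f /= addrC.
    by apply/andP; split=> //=; rewrite -addrA [y *: v + k]addrC.
  move=> [[y k] /andP[/= kp kZ] ->]; apply/andP; split; rewrite /f /=.
    by rewrite addrC memv_add ?memvZ ?memv_line.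
  by rewrite addrA.
rewrite -sum1_card (eq_bigr (fun y =>
    \sum_(l in [pred l in <[p]>%VS | (u + y *: v + l)%R \in Z]) 1)%N).
  by rewrite pair_big_dep.
by move=> y _; rewrite sum1_card.
Qed.

(** In the plane <p, v, u>, the lines on p are the one to v and those to
    u + y v. They cover the points of Z other than p, whose number is divisible
    by q; each line carries 0, 1 or q of them, and those carrying 1 are the
    non-tangent ones. *)
Lemma dvdn_sect v u : v \notin <[p]>%VS -> u \notin (<[p]> + <[v]>)%VS ->
  (q %| sect v + #|[pred y : F | ~~ tangent (u + y *: v)]|)%N.
Proof.
move=> vp up; have q1 := card_gt1 F.
have dl : \dim (<[p]> + <[v]>)%VS = 2%N by rewrite dim_add_line // dim_vline p0.
have := @dvdn_plane (<[p]> + <[v]> + <[u]>)%VS.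
rewrite dim_add_line // dl => /(_ erefl).
rewrite card_extend // card_extend_sect // z_sect // -addnA -mulnDr dvdn_addr //.
have cop : coprime q q.-1 by rewrite coprimenP // ltnW.
rewrite Gauss_dvdr //.
have -> : (\sum_y sect (u + y *: v) = #|[pred y : F | ~~ tangent (u + y *: v)]|
   + \sum_y q * (sect (u + y *: v) == q))%N.
  rewrite -[#|_|]sum1_card [X in (X + _)%N]big_mkcond -big_split.
  apply: eq_bigr => y _; rewrite inE /= negbK; case: (sect_cases (u + y *: v)) => -> /=.
  - by case: eqP => [e0|_]; rewrite ?muln0 // -e0.
  - by case: eqP => [e0|_]; rewrite ?muln0 // -e0 in q1 *.
  rewrite eqxx muln1; case: eqP => // e0; by rewrite e0 in q1.
by rewrite -big_distrr addnA dvdn_addl ?dvdn_mulr.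
Qed.

Lemma tangent_line v : v \in <[p]>%VS -> tangent v.
Proof.
by move=> vp; rewrite /tangent sect_line // neq_ltn card_gt1 orbT.
Qed.

Lemma tangentZ a v : tangent v -> tangent (a *: v).
Proof.
have [->|a0] := eqVneq a 0; last by rewrite /tangent sectZ.
by rewrite scale0r => _; apply/tangent_line/mem0v.
Qed.

Lemma tangentDl k v : k \in <[p]>%VS -> tangent (k + v) = tangent v.
Proof. by move=> kp; rewrite /tangent addrC sectD. Qed.

(** The lines to v and u are tangent, so among the q lines to u + y v fewer than
    q are 2-secants, yet their number is divisible by q. *)
Lemma tangentD u v : tangent u -> tangent v -> tangent (u + v).
Proof.
move=> Tu Tv.
have [vp|vp] := boolP (v \in <[p]>%VS); first by rewrite addrC tangentDl.
have [/memv_addP[k kp [_ /vlineP[a ->] ->]]|up] := boolP (u \in (<[p]> + <[v]>)%VS).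
  by rewrite -addrA tangentDl // -[v in _ + v]scale1r -scalerDl tangentZ.
have := dvdn_sect vp up; set A := [pred y | _] => dv.
have lt : (#|A| < q)%N.
  rewrite -(cardC A) -[X in (X < _)%N]addn0 ltn_add2l; apply/card_gt0P; exists 0.
  by rewrite !inE scale0r addr0 negbK.
have A0 : #|A| = 0%N.
  apply/eqP; rewrite -leqn0 leqNgt; apply/negP => A0.
  have : (q %| #|A|)%N.
    move: Tv dv; rewrite /tangent.
    by case: (sect_cases v) => -> // _; rewrite ?dvdn_addr.
  by rewrite gtnNdvd.
by have := card0_eq A0 1; rewrite !inE scale1r => /negbT; rewrite negbK.
Qed.

(** If the line to w is a 2-secant, the number of 2-secants among the lines to
    v + y w is -1 mod q, so it is not q. *)
Lemma tangent_comb v w : exists x y : F,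
  ((x != 0) || (y != 0)) /\ tangent (x *: v + y *: w).
Proof.
have [Tw|nTw] := boolP (tangent w).
  by exists 0, 1; rewrite oner_neq0 orbT scale0r add0r scale1r.
have wp : w \notin <[p]>%VS by apply: contra nTw; apply: tangent_line.
have [/memv_addP[k kp [_ /vlineP[a ->] vE]]|vp] := boolP (v \in (<[p]> + <[w]>)%VS).
  exists 1, (- a); rewrite oner_neq0 scale1r vE scaleNr addrK; split=> //.
  exact: tangent_line.
have := dvdn_sect wp vp; move: nTw; rewrite negbK => /eqP ->.
set A := [pred y | _] => dv.
have : (#|A| < q)%N.
  rewrite ltn_neqAle max_card andbT; apply: contraL dv => /eqP ->.
  by rewrite dvdn_addl // dvdn1 neq_ltn card_gt1 orbT.
rewrite -(cardC A) -[X in (X < _)%N]addn0 ltn_add2l => /card_gt0P[y].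
rewrite !inE negbK => Ty; exists 1, y; rewrite oner_neq0 scale1r; by split.
Qed.

Lemma tangent_proper : exists v, ~~ tangent v.
Proof.
have [v [vZ vp zl]] := secant_exists pZ p0; exists v.
rewrite negbK; rewrite z_sect // in zl; have q1 := card_gt1 F.
case: (sect_cases v) => sE; rewrite ?sE // in zl *.
  have : (0 < sect v)%N by apply/card_gt0P; exists 0; rewrite inE /= mem0v addr0.
  by rewrite sE.
by move: zl q1; clear; nia.
Qed.

Lemma tangent_n v : v \in <[n]>%VS -> tangent v.
Proof.
have [->|v0] := eqVneq v 0; first by move=> _; apply/tangent_line/mem0v.
move=> vn; have [/tangent_line //|vp] := boolP (v \in <[p]>%VS).
have dl : \dim (<[p]> + <[v]>)%VS = 2%N by rewrite dim_add_line // dim_vline p0.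
have nl : n \in (<[p]> + <[v]>)%VS.
  have nv : n \in <[v]>%VS.
    move: vn => /vlineP[a vE]; have a0 : a != 0.
      by apply: contraNneq v0 => a0; rewrite vE a0 scale0r.
    by rewrite -(scaled_mem _ _ a0) -vE memv_line.
  by rewrite (subvP (addvSr _ _)).
have := z_sect vp; rewrite line_on_n // /tangent; have := card_gt1 F.
by case: eqP => // ->; clear; lia.
Qed.

End Tangent.

Lemma scaled_n t : (t *: n \in Z) = (t == 0).
Proof.
have [->|t0] := eqVneq t 0; first by rewrite scale0r Z0.
by rewrite ZZE // (negPf nZ).
Qed.

Lemma n_neq0 : n != 0.
Proof. by apply: contraNneq nZ => ->. Qed.

(** A line on n has a single point of Z; this makes the projection along n from
    Z onto the quotient by <n> bijective, and phi below well defined. *)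
Lemma card_proj v : v \notin <[n]>%VS ->
  #|[pred l in <[n]>%VS | (v + l)%R \in Z]| = 1%N.
Proof.
move=> vn; have := card_extend vn; rewrite line_on_n; first last.
- exact: (subvP (addvSl _ _) _ (memv_line n)).
- by rewrite dim_add_line // dim_vline n_neq0.
have -> : z <[n]>%VS = #|pred1 (0 : V)|.
  apply: eq_card => l; rewrite -[LHS]/((l \in <[n]>%VS) && (l \in Z)) inE.
  apply/andP/eqP => [[/vlineP[t ->]]|->]; last by rewrite mem0v Z0.
  by rewrite scaled_n => /eqP ->; rewrite scale0r.
rewrite card1; have := card_gt1 F; move: #|[pred l in _ | _]| => c q1 E.
have q1' : (0 < q.-1)%N by move: q1; clear; lia.
by apply/eqP; rewrite -(eqn_pmul2l q1'); move: E q1'; clear; lia.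
Qed.

Lemma proj_exists v : exists t, v - t *: n \in Z.
Proof.
have [/vlineP[s ->]|vn] := boolP (v \in <[n]>%VS).
  by exists s; rewrite subrr Z0.
have /card_gt0P[l /andP[/= /vlineP[t ->] lZ]] :
    (0 < #|[pred l in <[n]>%VS | (v + l)%R \in Z]|)%N by rewrite card_proj.
by exists (- t); rewrite scaleNr opprK.
Qed.

Lemma proj_unique v s t : v - s *: n \in Z -> v - t *: n \in Z -> s = t.
Proof.
have [/vlineP[a ->]|vn] := boolP (v \in <[n]>%VS).
  by rewrite -!scalerBl !scaled_n !subr_eq0 => /eqP <- /eqP.
move=> hs ht.
have /card_le1P le1 : (#|[pred l in <[n]>%VS | (v + l)%R \in Z]| <= 1)%N.
  by rewrite card_proj.
have ns x : - (x *: n) \in <[n]>%VS by rewrite memvN memvZ ?memv_line.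
have := le1 (- (s *: n)); rewrite inE /= ns hs => /(_ isT (- (t *: n))).
rewrite !inE /= ns ht eqr_opp => /esym; rewrite -subr_eq0 -scalerBl.
by rewrite scaler_eq0 (negPf n_neq0) orbF subr_eq0 => /eqP.
Qed.

(** The affine coordinate along n, measured from Z. *)
Definition phi v := odflt 0 [pick t | v - t *: n \in Z].

Lemma phiP v : v - phi v *: n \in Z.
Proof.
rewrite /phi; case: pickP => [t //|h0]; have [t ht] := proj_exists v.
by have := h0 t; rewrite ht.
Qed.

Lemma phi_eq v t : v - t *: n \in Z -> phi v = t.
Proof. exact/proj_unique/phiP. Qed.

Lemma phi_eq0 v : (phi v == 0) = (v \in Z).
Proof.
apply/eqP/idP => [h0|vZ]; first by have := phiP v; rewrite h0 scale0r subr0.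
by apply: phi_eq; rewrite scale0r subr0.
Qed.

Lemma phiZ a v : phi (a *: v) = a * phi v.
Proof. by apply: phi_eq; rewrite -scalerA -scalerBr ZZ // phiP. Qed.

Lemma phi_shift v t : phi (v + t *: n) = phi v + t.
Proof. by apply: phi_eq; rewrite scalerDl opprD addrACA subrr addr0 phiP. Qed.

(** Both u and v may be moved along n onto Z, as n is tangent at every point of
    Z. Two vectors p, w of Z are then perpendicular when p + w is in Z, that is
    when their line has a third point in Z, which means that it is not a
    2-secant. *)
Lemma perpE u v : u \notin <[n]>%VS ->
  perp phi u v <-> tangent (u - phi u *: n) v.
Proof.
move=> un; set p := u - _.
have pZ : p \in Z := phiP u.
have p0 : p != 0.
  by apply: contraNneq un => /eqP; rewrite subr_eq0 => /eqP ->; rewrite memvZ ?memv_line.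
have nT t : tangent p (t *: n) by apply: tangent_n; rewrite ?memvZ ?memv_line.
set w := v - phi v *: n; have wZ : w \in Z := phiP v.
have -> : tangent p v = tangent p w.
  apply/idP/idP => Tv; last first.
    by rewrite -(subrK (phi v *: n) v); apply: tangentD.
  by rewrite /w -scaleNr; apply: tangentD.
have -> : perp phi u v <-> p + w \in Z.
  rewrite /perp /p /w addrACA -opprD -scalerDl; split=> [<-|/phi_eq //].
  exact: phiP.
have sp : (0 < sect p w)%N.
  by apply/card_gt0P; exists 0; rewrite inE /= mem0v addr0.
split=> [pw|Tw].
  rewrite /tangent neq_ltn orbC; apply/orP; left.
  apply/card_gt1P; exists 0, p.
  by rewrite !inE /= mem0v addr0 wZ memv_line addrC pw eq_sym.
have sq : sect p w = q.
  by case: (sect_cases pZ p0 w) sp Tw => sE; rewrite /tangent sE.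
have := @subset_leqif_card _ [pred l in <[p]>%VS | (w + l)%R \in Z] (mem <[p]>%VS).
case; first by apply/subsetP => l /andP[].
rewrite -/(sect p w) sq card_line // leqnn eqxx => _ /esym/subsetP/(_ p).
by rewrite inE /= memv_line addrC => /(_ isT) /andP[].
Qed.

Lemma quadratic_set : exists A : 'M[F]_5,
  [/\ forall v, (v \in Z) = (qform A v == 0),
      nonsingular_on A fullv,
      forall v, polar A v n = 0
    & forall S : {vspace V}, \dim S = 4%N -> n \in S -> exists p,
        [/\ p \in S, p != 0, p \in Z & forall s, s \in S -> polar A p s = 0]].
Proof.
have dich u : (exists t, u = t *: n) \/ u \notin <[n]>%VS.
  by have [/vlineP|] := boolP (u \in <[n]>%VS); [left|right].
have perp_line t v : perp phi (t *: n) v.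
  by apply: perpC; rewrite /perp phi_shift (phin phiZ phi_shift).
have pZ u : u - phi u *: n \in Z := phiP u.
have p0 u : u \notin <[n]>%VS -> u - phi u *: n != 0.
  by apply: contraNneq => /eqP; rewrite subr_eq0 => /eqP ->; rewrite memvZ ?memv_line.
have perpZr a u v : perp phi u v -> perp phi u (a *: v).
  case: (dich u) => [[t ->] _|un]; first exact: perp_line.
  by rewrite !perpE //; apply: tangentZ; auto.
have perpDr u v w : perp phi u v -> perp phi u w -> perp phi u (v + w).
  case: (dich u) => [[t ->] _ _|un]; first exact: perp_line.
  by rewrite !perpE //; apply: tangentD; auto.
have perp_comb u v w : exists x y : F,
    ((x != 0) || (y != 0)) /\ perp phi u (x *: v + y *: w).
  case: (dich u) => [[t ->]|un].
    by exists 1, 0; rewrite oner_neq0; split=> //; exact: perp_line.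
  have [x [y [xy h]]] := tangent_comb (pZ u) (p0 u un) v w.
  by exists x, y; split=> //; rewrite perpE.
have perp_nondeg u : (forall v, perp phi u v) -> exists t, u = t *: n.
  case: (dich u) => // un h; have [v] := tangent_proper (pZ u) (p0 u un).
  by move/negP; case; apply/perpE.
have [A AE] := perp_quadratic char2 phiZ phi_shift perpZr perpDr perp_comb perp_nondeg.
(* Squaring is additive in characteristic 2. *)
have polE u v : polar A u v = (phi (u + v) - phi u - phi v) ^+ 2.
  by rewrite /polar !AE !(sqrD2 char2) !sqrrN !(oppr_pchar2 char2).
have polP u v : polar A u v = 0 <-> perp phi u v.
  rewrite polE /perp -addrA -opprD; split=> [/eqP|->]; last by rewrite subrr expr0n.
  by rewrite expf_eq0 /= subr_eq0 => /eqP.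
exists A; split.
- by move=> v; rewrite AE expf_eq0 /= phi_eq0.
- move=> v _; rewrite AE => /eqP; rewrite expf_eq0 /= phi_eq0 => vZ h.
  have [w|t vE] := perp_nondeg v; first by apply/polP/h/memvf.
  by move: vZ; rewrite vE scaled_n => /eqP ->; rewrite scale0r.
- by move=> v; apply/polP; rewrite -[n]scale1r; apply: (perpn phiZ phi_shift).
move=> S dS nS; have [p [pS p_neq0 php hp]] :=
  perp_radical char2 phiZ phi_shift perpZr perpDr perp_comb dS nS.
by exists p; split=> // [|s /hp/polP //]; rewrite -phi_eq0 php.
Qed.

End QuadraticSet.

(** * Moments of hyperplane sections *)

Section Cones.

Variables (F : finFieldType) (n : nat).
Local Notation V := 'rV[F]_n.
Local Notation q := #|F|.

(** The vectors of a set of points, without 0. *)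
Variable (B : {pred V}).
Hypothesis B0 : 0 \notin B.
Hypothesis BZ : forall a v, a != 0 -> v \in B -> a *: v \in B.

Lemma cone_line v : v \in B -> #|[predI B & <[v]>%VS]| = q.-1.
Proof.
move=> vB; have v0 : v != 0 by apply: contraNneq B0 => <-.
have -> : #|[predI B & <[v]>%VS]| = #|[predD1 <[v]>%VS & (0 : V)%R]|.
  apply: eq_card => u; rewrite !inE andbC.
  case: (boolP (u \in <[v]>%VS)) => [/vlineP[a ->]|]; rewrite ?andbF ?andbT //=.
  rewrite scaler_eq0 (negPf v0) orbF; have [->|a0] := eqVneq a 0.
    by rewrite scale0r (negPf B0).
  by rewrite BZ.
have := cardD1 (0 : V) <[v]>%VS; rewrite mem0v cardv dim_vline v0 expn1 => ->.
by rewrite add1n.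
Qed.

Lemma cone_first_moment :
  (q * (\sum_(v : V) #|[predI B & hyp v]|) = q ^ n * #|B|)%N.
Proof.
have := sum_card_cap_hyp (fullv : {vspace V}) B; rewrite sum_cap_hyp cardV.
have -> : #|[predI B & orth (fullv : {vspace V})]| = 0%N.
  apply: eq_card0 => w; rewrite inE /=; apply/andP => -[wB /orthP h].
  have /dot_neq0[v] : w != 0 by apply: contraNneq B0 => <-.
  by rewrite dotC h ?memvf ?eqxx.
rewrite !muln0 !addn0 => <-; congr (_ * _)%N; apply: eq_bigl => v.
by rewrite memvf.
Qed.

(** The sum counts triples (v, w, w') with w, w' in B and v on both hyperplanes;
    for fixed w it is a first moment over the subspace hyp w, in which exactly
    the q - 1 multiples w' of w impose no further condition. *)
Lemma cone_second_moment :
  (q ^ 2 * (\sum_(v : V) #|[predI B & hyp v]| ^ 2)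
   = #|B| * (q ^ n * (#|B| + q.-1 ^ 2)))%N.
Proof.
have -> : (\sum_(v : V) #|[predI B & hyp v]| ^ 2 =
  \sum_(w in B) \sum_(v in hyp w) #|[predI B & hyp v]|)%N.
  transitivity (\sum_(v : V) \sum_(w in [predI B & hyp v]) #|[predI B & hyp v]|)%N.
    by apply: eq_bigr => v _; rewrite sum_nat_const mulnn.
  rewrite (exchange_big_dep (mem B)) /= => [|v w _ /andP[] //].
  apply: eq_bigr => w wB; apply: eq_bigl => v.
  by rewrite inE /= wB mem_hypC.
rewrite big_distrr -sum_nat_const; apply: eq_bigr => w wB /=.
have w0 : w != 0 by apply: contraNneq B0 => <-.
have := sum_card_cap_hyp (hyp w) B; rewrite sum_cap_hyp.
have -> : #|[predI B & orth (hyp w)]| = q.-1.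
  rewrite -(cone_line wB); apply: eq_card => v.
  by rewrite !inE -(orth_line w) orthK.
have := card_hyp w0; have := card_gt1 F.
set t := (\sum_(v in _) _)%N; case: q => // c _ <- /= h.
have -> : (c.+1 ^ 2 * t = c.+1 * (c.+1 * t))%N by rewrite mulnA mulnn.
rewrite -!mulnA; congr (_ * _)%N; move: h.
by clear; move: #|_| t #|_| => x t b; lia.
Qed.

End Cones.

Lemma dim_hyp (F : finFieldType) (w : 'rV[F]_5) : w != 0 -> \dim (hyp w) = 4%N.
Proof.
by move=> w0; have := dim_orth <[w]>%VS; rewrite orth_line dim_vline w0 => -[].
Qed.

(** * Intersection numbers of the heavy points *)

Section Counting.

Variables (F : finFieldType) (r g e : nat).
Local Notation V := 'rV[F]_5.
Local Notation q := #|F|.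
Hypotheses (qr : q = (r * 2)%N) (qg : q = (g + 1)%N) (qe : q = (2 ^ e)%N).

(** K is the cone of the functionals whose kernels are the solids of H, and k0
    the number of these solids. *)
Variables (K : {set V}) (k0 : nat).
Hypothesis K0 : 0 \notin K.
Hypothesis KZ : forall a v, a != 0 -> v \in K -> a *: v \in K.
Hypothesis K_neq0 : K != set0.
Hypothesis K_card : #|K| = (g * k0)%N.

(** The counts of functionals are g = q - 1 times those of solids. *)
Definition weight (v : V) := #|[predI K & hyp v]|.
Definition mult (X : {vspace V}) := #|[predI K & orth X]|.

Hypothesis condI : forall v, v != 0 ->
  [\/ weight v = 0%N, weight v = (g * (r * q ^ 2))%N
    | weight v = (g * (r * (q * (q + 1))))%N].
Hypothesis condII : forall E : {vspace V}, \dim E = 3%N -> mult E != 0%N ->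
  (g * r <= mult E)%N.

(** The cone of the point set Q; it contains 0 so that it can be compared with
    subspaces. *)
Definition heavy := [set v | (v == 0) || (weight v == g * (r * (q * (q + 1))))%N].
Definition light := [set v | (v != 0) && (weight v == 0%N)].

Lemma g_gt0 : (0 < g)%N. Proof. by have := card_gt1 F; rewrite qg; case: g. Qed.
Lemma r_gt0 : (0 < r)%N. Proof. by have := card_gt1 F; rewrite qr; case: r. Qed.

Lemma weightZ a v : a != 0 -> weight (a *: v) = weight v.
Proof.
move=> a0; apply: eq_card => w; rewrite !inE /= !mem_hyp dotZr mulf_eq0.
by rewrite (negPf a0).
Qed.

Lemma weight0 : weight 0 = #|K|.
Proof. by apply: eq_card => w; rewrite inE /= mem_hyp dot0r eqxx andbT. Qed.

Lemma heavy_scaled a v : a != 0 -> (a *: v \in heavy) = (v \in heavy).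
Proof. by move=> a0; rewrite !inE scaler_eq0 weightZ // (negPf a0). Qed.

Lemma heavy0 : 0 \in heavy. Proof. by rewrite inE eqxx. Qed.

Definition medium := [set v | (v \notin light) && (v \notin heavy)].

Lemma weight_cases v : v != 0 ->
  [\/ [/\ weight v = 0%N, v \in light, (v \in medium) = false & (v \in heavy) = false],
      [/\ weight v = (g * (r * q ^ 2))%N, (v \in light) = false,
          v \in medium & (v \in heavy) = false]
    | [/\ weight v = (g * (r * (q * (q + 1))))%N, (v \in light) = false,
          (v \in medium) = false & v \in heavy]].
Proof.
move=> v0; rewrite !inE v0 (negPf v0) /=; have := condI v0.
have -> : (g * (r * (q * (q + 1))) = g * (r * q ^ 2) + g * (r * q))%N by ring.
have b0 : (0 < g * (r * q))%N by rewrite !muln_gt0 g_gt0 r_gt0 qg addn1.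
have a0 : (0 < g * (r * q ^ 2))%N.
  by rewrite !muln_gt0 g_gt0 r_gt0 ?expn_gt0 qg addn1.
move: (g * (r * q ^ 2))%N (g * (r * q))%N a0 b0 => a b a0 b0.
case=> ->; [constructor 1|constructor 2|constructor 3].
all: by split=> //; clear -a0 b0; lia.
Qed.

Lemma sum_pred0 (X : {vspace V}) c : (\sum_(v in X) (v == 0%R) * c = c)%N.
Proof.
rewrite (bigD1 0%R) ?mem0v //= eqxx mul1n big1 ?addn0 // => v /andP[_ /negPf ->].
by rewrite mul0n.
Qed.

Lemma sum_predM (T : finType) (A B : {pred T}) c :
  (\sum_(v in A) (v \in B) * c = #|[predI A & B]| * c)%N.
Proof.
rewrite -big_distrl /= -sum1_card; congr (_ * _)%N.
rewrite big_mkcond [RHS]big_mkcond; apply: eq_bigr => v _.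
by rewrite inE /=; case: (v \in A); case: (v \in B).
Qed.

(** Nonzero vectors contribute g r q^2 unless they are light, and g r q more if
    they are heavy; the second and third term on the left correct for the light
    vectors and for 0, which is heavy but has weight |K|. *)
Lemma sum_weight (X : {vspace V}) :
  (\sum_(v in X) weight v + g * (r * (q * (q + 1)))
     + #|[predI X & light]| * (g * (r * q ^ 2)) =
   #|K| + #|X| * (g * (r * q ^ 2)) + #|[predI X & heavy]| * (g * (r * q)))%N.
Proof.
rewrite -[X in (_ + X + _)%N](sum_pred0 X) -[in RHS](sum_pred0 X #|K|).
rewrite -!sum_predM -[(#|X| * _)%N]sum_nat_const -!big_split /=; apply: eq_bigr => v _.
have [->|v0] := eqVneq v 0.
  by rewrite weight0 heavy0 !inE eqxx /=; ring.
by case: (weight_cases v0) => -[-> -> _ ->] /=; ring.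
Qed.

Lemma sum_fullv (f : V -> nat) : (\sum_v f v = \sum_(v in (fullv : {vspace V})) f v)%N.
Proof. by apply: eq_bigl => v; rewrite memvf. Qed.

Lemma card_capfv (A : {set V}) : #|[predI (fullv : {vspace V}) & A]| = #|A|.
Proof. by apply: eq_card => v; rewrite inE /= memvf. Qed.

Lemma moment1 :
  (k0 + #|medium| * (r * q ^ 2) + #|heavy|.-1 * (r * (q * (q + 1))) = q ^ 4 * k0)%N.
Proof.
have q0 : (0 < q)%N by rewrite qg addn1.
have Zp : (0 < #|heavy|)%N by rewrite (cardD1 0) heavy0.
have /eqP := cone_first_moment K0; rewrite expnS -mulnA eqn_pmul2l // => /eqP sE.
have : (\sum_(v : V) #|[predI K & hyp v]| + g * (r * (q * (q + 1))) = #|K| +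
    #|medium| * (g * (r * q ^ 2)) + #|heavy| * (g * (r * (q * (q + 1)))))%N.
  rewrite sum_fullv -[X in (_ + X)%N](sum_pred0 fullv).
  rewrite -[X in (X + _ + _)%N](sum_pred0 fullv).
  rewrite -[#|medium|]card_capfv -[#|heavy|]card_capfv -!sum_predM -!big_split /=.
  apply: eq_bigr => v _; have [->|v0] := eqVneq v 0.
    by rewrite -/(weight 0) weight0 !inE eqxx /=; ring.
  by rewrite -/(weight v); case: (weight_cases v0) => -[-> _ -> ->] /=; ring.
rewrite sE -(prednK Zp) K_card => E.
apply/eqP; rewrite -(eqn_pmul2l g_gt0); apply/eqP.
apply: (@addIn (g * (r * (q * (q + 1))))%N).
transitivity (g * k0 + #|medium| * (g * (r * q ^ 2))
  + #|heavy|.-1.+1 * (g * (r * (q * (q + 1)))))%N; first by ring.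
by rewrite -E; ring.
Qed.

Lemma moment2 :
  (k0 ^ 2 + #|medium| * (r * q ^ 2) ^ 2 + #|heavy|.-1 * (r * (q * (q + 1))) ^ 2 =
    k0 * (q ^ 3 * (k0 + g)))%N.
Proof.
have q0 : (0 < q ^ 2)%N by rewrite expn_gt0 qg addn1.
have Zp : (0 < #|heavy|)%N by rewrite (cardD1 0) heavy0.
have sE : (\sum_(v : V) #|[predI K & hyp v]| ^ 2 = #|K| * (q ^ 3 * (#|K| + g ^ 2)))%N.
  apply/eqP; rewrite -(eqn_pmul2l q0) cone_second_moment //; apply/eqP.
  have -> : q.-1 = g by rewrite qg addn1.
  ring.
have : (\sum_(v : V) #|[predI K & hyp v]| ^ 2 + (g * (r * (q * (q + 1)))) ^ 2 = #|K| ^ 2 +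
    #|medium| * (g * (r * q ^ 2)) ^ 2 + #|heavy| * (g * (r * (q * (q + 1)))) ^ 2)%N.
  rewrite sum_fullv -[X in (_ + X)%N](sum_pred0 fullv).
  rewrite -[X in (X + _ + _)%N](sum_pred0 fullv).
  rewrite -[#|medium|]card_capfv -[#|heavy|]card_capfv -!sum_predM -!big_split /=.
  apply: eq_bigr => v _; have [->|v0] := eqVneq v 0.
    by rewrite -/(weight 0) weight0 !inE eqxx /=; ring.
  by rewrite -/(weight v); case: (weight_cases v0) => -[-> _ -> ->] /=; ring.
rewrite sE -(prednK Zp) K_card => E.
apply/eqP; rewrite -(eqn_pmul2l g_gt0) -(eqn_pmul2l g_gt0); apply/eqP.
apply: (@addIn ((g * (r * (q * (q + 1)))) ^ 2)%N).
transitivity ((g * k0) ^ 2 + #|medium| * (g * (r * q ^ 2)) ^ 2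
  + #|heavy|.-1.+1 * (g * (r * (q * (q + 1)))) ^ 2)%N; first by ring.
by rewrite -E; ring.
Qed.

Lemma parameters : k0 = (r * (q * (q ^ 2 + 1)))%N /\ #|light| = g.
Proof.
have k0p : (0 < k0)%N.
  rewrite lt0n; apply/eqP => k00; have := K_neq0.
  by rewrite -card_gt0 K_card k00 muln0.
apply: (design_parameters qe qr qg g_gt0 k0p moment1 moment2).
have Zp : (0 < #|heavy|)%N by rewrite (cardD1 0) heavy0.
rewrite -!addnA [(_ + 1)%N]addn1 prednK // addnA.
have -> : (#|light| + #|medium| = #|[predC heavy]|)%N.
  rewrite -(cardID light [predC heavy]); congr (_ + _)%N; apply: eq_card => v.
    rewrite -[RHS]/((v \notin heavy) && (v \in light)).
    have [->|v0] := eqVneq v 0; first by rewrite !inE eqxx.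
    by case: (weight_cases v0) => -[_ -> _ ->].
  by rewrite !inE.
by rewrite addnC cardC card_mx mul1n.
Qed.

(** The light vectors are as numerous as the nonzero multiples of any one of
    them, and they are closed under scaling. *)
Lemma nucleus_exists : exists2 n : V, n != 0 &
  forall v, (v \in light) = (v != 0) && (v \in <[n]>%VS).
Proof.
have [_ cN] := parameters.
have /card_gt0P[n nN] : (0 < #|light|)%N by rewrite cN g_gt0.
have n0 : n != 0 by move: nN; rewrite inE => /andP[].
exists n => //.
pose L := [set v in <[n]>%VS | v != 0].
have LN : L \subset light.
  apply/subsetP => v; rewrite !inE => /andP[/vlineP[a ->] an0].
  have a0 : a != 0 by apply: contraNneq an0 => ->; rewrite scale0r.
  rewrite an0 weightZ //.
  by move: nN; rewrite inE => /andP[].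
have cL : #|L| = g.
  have := cardD1 (0 : V) <[n]>%VS; rewrite mem0v cardv dim_vline n0 expn1 qg addn1 add1n.
  by move=> [->]; apply: eq_card => v; rewrite !inE andbC.
have /eqP <- : L == light by rewrite eqEcard LN cL cN leqnn.
by move=> v; rewrite !inE andbC.
Qed.

Variable n : V.
Hypothesis n_neq0 : n != 0.
Hypothesis lightE : forall v, (v \in light) = (v != 0) && (v \in <[n]>%VS).

Definition heavy_count (X : {vspace V}) := #|[predI X & heavy]|.

Lemma q_gt0 : (0 < q)%N. Proof. by rewrite qg addn1. Qed.

Lemma card_cap_light (X : {vspace V}) : #|[predI X & light]| = ((n \in X) * g)%N.
Proof.
have [nX|nX] := boolP (n \in X).
  rewrite mul1n -parameters.2; apply: eq_card => v; rewrite inE /= lightE.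
  case: (boolP (v \in <[n]>%VS)) => [/vlineP[a ->]|_]; last by rewrite !andbF.
  by rewrite memvZ.
rewrite mul0n; apply: eq_card0 => v; rewrite inE /= lightE; apply/and3P => -[vX v0].
move=> /vlineP[a vE]; move: nX; rewrite -[n]scale1r -(@mulVf _ a).
  by rewrite -scalerA -vE memvZ.
by apply: contraNneq v0 => a0; rewrite vE a0 scale0r.
Qed.

Lemma K_off_n w : w \in K -> n \notin hyp w.
Proof.
move=> wK; have : n \in light by rewrite lightE n_neq0 memv_line.
rewrite inE => /andP[_ /eqP/card0_eq/(_ w)]; rewrite inE /= wK /=.
by rewrite mem_hypC => ->.
Qed.

Lemma mult_eq0 (X : {vspace V}) : n \in X -> mult X = 0%N.
Proof.
move=> nX; apply: eq_card0 => w; rewrite inE /=; apply/andP => -[/K_off_n].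
by rewrite -sub_hyp => nw /subvP/(_ _ nX); rewrite (negPf nw).
Qed.

(** The sum of the weights over X is known in terms of light and heavy vectors
    from [sum_weight], and in terms of the functionals vanishing on X by double
    counting. *)
Lemma heavy_count_formula (X : {vspace V}) x : #|X| = (q * x)%N ->
  (r * q * (q ^ 2 + heavy_count X) =
   x * (r * q + mult X) + r * q ^ 2 * (1 + (n \in X) * g))%N.
Proof.
move=> cX; have E1 := sum_weight X; have E2 := sum_card_cap_hyp X (mem K).
rewrite sum_cap_hyp cX -!/(mult X) in E2.
have {}E2 : (\sum_(v in X) weight v + x * mult X = x * #|K| + q * x * mult X)%N.
  apply/eqP; rewrite -(eqn_pmul2l q_gt0); apply/eqP; rewrite /weight.
  by transitivity (q * x * #|K| + q * (q * x) * mult X)%N; [rewrite -E2|]; ring.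
have q1 := addn1 g.
have kE : #|K| = (g * (r * (q * (q ^ 2 + 1))))%N by rewrite K_card parameters.1.
rewrite card_cap_light cX -/(heavy_count X) kE in E1; rewrite kE in E2.
apply/eqP; rewrite -(eqn_pmul2l g_gt0); apply/eqP.
move: E1 E2; move: (\sum_(v in X) _)%N (heavy_count X) (mult X) (nat_of_bool _).
move=> S Z M nu.
rewrite [#|F|]qg; clear; lia.
Qed.

Lemma rq_gt0 : (0 < r * q)%N. Proof. by rewrite muln_gt0 r_gt0 q_gt0. Qed.

Lemma plane_count (E : {vspace V}) : \dim E = 3%N ->
  heavy_count E = (2 * mult E + q * (1 + (n \in E) * g))%N.
Proof.
move=> dE; have /heavy_count_formula h : #|E| = (q * q ^ 2)%N by rewrite cardv dE.
apply/eqP; rewrite -(eqn_pmul2l rq_gt0); apply/eqP.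
apply: (@addnI (r * q * q ^ 2)%N); rewrite -mulnDr h qr; ring.
Qed.

Lemma solid_count (S : {vspace V}) : \dim S = 4%N ->
  (q ^ 2 + heavy_count S = q ^ 3 + 2 * q * mult S + q * (1 + (n \in S) * g))%N.
Proof.
move=> dS; have /heavy_count_formula h : #|S| = (q * q ^ 3)%N by rewrite cardv dS.
by apply/eqP; rewrite -(eqn_pmul2l rq_gt0) h qr; apply/eqP; ring.
Qed.

Lemma line_count (l : {vspace V}) : \dim l = 2%N ->
  (r * (q ^ 2 + heavy_count l) = r * q + mult l + r * q * (1 + (n \in l) * g))%N.
Proof.
move=> dl; have /heavy_count_formula h : #|l| = (q * q)%N by rewrite cardv dl.
apply/eqP; rewrite -(eqn_pmul2l q_gt0) mulnCA mulnA h; apply/eqP; ring.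
Qed.

Lemma mult_hyp w : w != 0 -> mult (hyp w) = ((w \in K) * g)%N.
Proof.
move=> w0; rewrite /mult -orth_line orthK; have [wK|wK] := boolP (w \in K).
  by rewrite (cone_line K0 KZ wK) qg addn1 mul1n.
rewrite mul0n; apply: eq_card0 => v; rewrite inE /=; apply/andP => -[vK].
move=> /vlineP[a vE]; have a0 : a != 0.
  by apply: contraTneq vK => a0; rewrite vE a0 scale0r.
by move: wK; rewrite -[w]scale1r -(mulVf a0) -scalerA -vE KZ // invr_eq0.
Qed.

(** The functionals vanishing on X but not at n; all functionals of K vanishing
    on X are among them. For a plane they belong to q solids, which bounds the
    multiplicity in [mult_le]. *)
Lemma card_orth_off (X : {vspace V}) : n \notin X ->
  (#|[predD orth X & hyp n]| + q ^ (4 - \dim X) = q ^ (5 - \dim X))%N.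
Proof.
move=> nX; have nX' : n \notin orth (orth X) by rewrite orthK.
have dX : (\dim (orth X) = 5 - \dim X)%N by have := dim_orth X; lia.
have dX' : (\dim (orth X :&: hyp n) = 4 - \dim X)%N.
  by have := dim_cap_hyp nX'; lia.
rewrite -dX -dX' -!cardv -(cardID (hyp n) (orth X)) addnC; congr (_ + _)%N.
by apply: eq_card => v; rewrite !inE memv_cap.
Qed.

Lemma mult_sub (X : {vspace V}) : {subset [predI K & orth X] <= [predD orth X & hyp n]}.
Proof.
by move=> w; rewrite !inE /= => /andP[/K_off_n + ->]; rewrite mem_hypC => ->.
Qed.

Lemma mult_le (X : {vspace V}) : n \notin X ->
  (mult X + q ^ (4 - \dim X) <= q ^ (5 - \dim X))%N.
Proof.
move=> nX; rewrite -(card_orth_off nX) leq_add2r; apply/subset_leq_card.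
by apply/subsetP/mult_sub.
Qed.

Lemma mult_lt (X : {vspace V}) w : n \notin X -> w \in orth X -> w \notin hyp n ->
  w \notin K -> (mult X + q ^ (4 - \dim X) < q ^ (5 - \dim X))%N.
Proof.
move=> nX wX wn wK; rewrite -(card_orth_off nX) ltn_add2r; apply: proper_card.
apply/properP; split; first by apply/subsetP/mult_sub.
by exists w; rewrite !inE /= ?wn // (negPf wK).
Qed.

Lemma mult_full (X : {vspace V}) : n \notin X ->
  (forall w, w \in orth X -> w \notin hyp n -> w \in K) ->
  (mult X + q ^ (4 - \dim X) = q ^ (5 - \dim X))%N.
Proof.
move=> nX hK; rewrite -(card_orth_off nX); congr (_ + _)%N; apply: eq_card => w.
apply/idP/idP; first exact: mult_sub.
by rewrite !inE /= => /andP[wn wX]; rewrite hK.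
Qed.

Lemma heavy_count_predD1 (X : {vspace V}) :
  heavy_count X = #|[predD1 [predI X & heavy] & 0]|.+1.
Proof. by rewrite /heavy_count (cardD1 0) inE /= mem0v heavy0. Qed.

(** ** The planes of a solid of H *)

Section SolidOfK.

Variable w0 : V.
Hypothesis w0K : w0 \in K.
Let S := hyp w0.
Let B := [predD1 [predI S & heavy] & 0].
(** y w / (q - 1) is the number of heavy points in the plane of S cut out by w.
    The bounds on y below are q - 1 times q + 1 and q - 1 times 2q + 1. *)
Let y w := #|[predI B & hyp w]|.

Let w0_neq0 : w0 != 0. Proof. by apply: contraNneq K0 => <-. Qed.
Let nS : n \notin S. Proof. exact: K_off_n. Qed.

Let mB v : (v \in B) = [&& v != 0, v \in S & v \in heavy].
Proof. by []. Qed.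

Let B0 : 0 \notin B. Proof. by rewrite mB eqxx. Qed.

Let BZ a v : a != 0 -> v \in B -> a *: v \in B.
Proof.
move=> a0; rewrite !mB heavy_scaled //.
by case/and3P => v0 vS ->; rewrite memvZ // andbT scaler_eq0 negb_or a0 v0.
Qed.

Let yz w : heavy_count (S :&: hyp w) = (y w).+1.
Proof.
rewrite heavy_count_predD1; congr _.+1; apply: eq_card => v.
rewrite -[RHS]/((v \in B) && (v \in hyp w)) mB.
rewrite -[LHS]/((v != 0) && ((v \in (S :&: hyp w)%VS) && (v \in heavy))) memv_cap.
by rewrite -!andbA; congr (_ && (_ && _)); rewrite andbC.
Qed.

(** A solid of H has (q + 1)^2 heavy points, with g vectors each. *)
Let card_B : #|B| = (g * (g + 2) ^ 2)%N.
Proof.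
have := solid_count (dim_hyp w0_neq0); rewrite (negPf nS) mult_hyp // w0K mul1n.
rewrite heavy_count_predD1 -/S -/B qg; move: #|B| => b; clear; lia.
Qed.

Let dim_plane w : w \notin <[w0]>%VS -> \dim (S :&: hyp w) = 3%N.
Proof.
move=> ww0; have := dim_hyp w0_neq0; rewrite -/S.
by rewrite -(@dim_cap_hyp _ _ S w) ?/S -?orth_line ?orthK // => -[].
Qed.

(** Condition (II), since the plane lies in the solid S of H. *)
Let y_ge w : w \notin <[w0]>%VS -> (g * (g + 2) <= y w)%N.
Proof.
move=> ww0; have dE := dim_plane ww0.
have nE : n \notin (S :&: hyp w)%VS by rewrite memv_cap (negPf nS).
have mE : mult (S :&: hyp w) != 0%N.
  rewrite -lt0n; apply/card_gt0P; exists w0.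
  by rewrite inE /= w0K -sub_hyp capvSl.
have := plane_count dE; rewrite (negPf nE) yz; have := condII dE mE.
by move: (y w) (mult _) qr; rewrite qg; clear; lia.
Qed.

(** Of the q + 1 solids on the plane, the one on n is not in H. *)
Let y_le w : w \notin <[w0]>%VS -> (y w <= g * (2 * g + 3))%N.
Proof.
move=> ww0; have dE := dim_plane ww0.
have nE : n \notin (S :&: hyp w)%VS by rewrite memv_cap (negPf nS).
have := plane_count dE; rewrite (negPf nE) yz.
have : (mult (S :&: hyp w) + q ^ 1 <= q ^ 2)%N by have := mult_le nE; rewrite dE.
rewrite qg; move: (y w) (mult _); clear; lia.
Qed.

(** With f w the product of the distances of y w to its two bounds, f is a
    nonnegative quadratic polynomial in y, and its sum over the planes of S is
    determined by the first two moments of y. It vanishes, so each plane attains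
    one of the bounds. *)
Lemma solid_planes w : w \notin <[w0]>%VS ->
  (heavy_count (S :&: hyp w) = q ^ 2 \/ heavy_count (S :&: hyp w) + q = 2 * q ^ 2)%N.
Proof.
pose f w := ((y w - g * (g + 2)) * (g * (2 * g + 3) - y w))%N.
have key : (\sum_(w | w \notin <[w0]>%VS) f w = 0)%N.
  have s1 : (\sum_w y w = q ^ 4 * #|B|)%N.
    by apply/eqP; rewrite -(eqn_pmul2l q_gt0) cone_first_moment // mulnA -expnS.
  have s2 : (\sum_w y w ^ 2 = #|B| * (q ^ 3 * (#|B| + g ^ 2)))%N.
    have q2 : (0 < q ^ 2)%N by rewrite expn_gt0 q_gt0.
    apply/eqP; rewrite -(eqn_pmul2l q2) cone_second_moment // qg addn1 /=.
    by apply/eqP; ring.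
  have yP u : u \in <[w0]>%VS -> y u = #|B|.
    move=> /vlineP[a ->]; apply: eq_card => v.
    rewrite -[LHS]/((v \in B) && (v \in hyp _)) -[RHS]/(v \in B) !mB.
    rewrite (mem_hyp v (a *: w0)) dotZr /S mem_hyp.
    have [->|_] := eqVneq (dot v w0) 0; first by rewrite mulr0 eqxx !andbT.
    by rewrite andbF.
  have cP : #|<[w0]>%VS| = q by rewrite cardv dim_vline w0_neq0 expn1.
  have cP' : (q + #|[predC <[w0]>%VS]| = q ^ 5)%N.
    by rewrite -[in LHS]cP cardC card_mx mul1n.
  (* The multiples of w0 do not define a plane of S and are removed from both
     moments. *)
  rewrite (bigID (mem <[w0]>%VS)) /= in s1; rewrite (bigID (mem <[w0]>%VS)) /= in s2.
  rewrite (eq_bigr _ yP) sum_nat_const cP in s1.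
  have e2 : (\sum_(w in <[w0]>%VS) y w ^ 2 = q * #|B| ^ 2)%N.
    by rewrite -cP -sum_nat_const; apply: eq_bigr => u /yP ->.
  rewrite e2 in s2.
  have : (\sum_(w | w \notin <[w0]>%VS) y w ^ 2 + \sum_(w | w \notin <[w0]>%VS) f w +
     #|[predC <[w0]>%VS]| * (g * (g + 2) * (g * (2 * g + 3))) =
     (g * (g + 2) + g * (2 * g + 3)) * (\sum_(w | w \notin <[w0]>%VS) y w))%N.
    rewrite -sum_nat_const -!big_split big_distrr /=; apply: eq_bigr => u hu.
    (* For lower bound a and upper bound b = a + d + c with y = a + d:
       y^2 + d c + a b = (a + b) y. *)
    have [c bE] : exists c, (g * (2 * g + 3))%N = (y u + c)%N.
      by exists (g * (2 * g + 3) - y u)%N; rewrite subnKC ?y_le.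
    have [d yE] : exists d, y u = (g * (g + 2) + d)%N.
      by exists (y u - g * (g + 2))%N; rewrite subnKC ?y_ge.
    by rewrite /f bE addKn yE addKn; ring.
  have := congr1 (muln (g * (g + 2) * (g * (2 * g + 3)))) cP'.
  have := congr1 (muln (g * (g + 2) + g * (2 * g + 3))) s1.
  move: s2; rewrite card_B; move: (\sum_(w | _) y w ^ 2)%N (\sum_(w | _) f w)%N.
  move: (\sum_(w | _) y w)%N #|[predC _]| => Sy C Sy2 Sf.
  rewrite qg; clear; lia.
move=> hw; have := y_ge hw; have := y_le hw.
have : f w == 0%N.
  by move/eqP: key; rewrite sum_nat_eq0 => /forallP/(_ w)/implyP/(_ hw).
rewrite /f muln_eq0 yz qg; move: (y w); clear; lia.
Qed.

End SolidOfK.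

Lemma plane_cases (E : {vspace V}) : \dim E = 3%N -> mult E != 0%N ->
  (heavy_count E = q ^ 2 \/ heavy_count E + q = 2 * q ^ 2)%N.
Proof.
move=> dE; rewrite -lt0n => /card_gt0P[w0]; rewrite inE /= => /andP[w0K w0E].
have w00 : w0 != 0 by apply: contraNneq K0 => <-.
have [w wE ww0] : exists2 w, w \in orth E & w \notin <[w0]>%VS.
  apply: exists_outside; have := dim_orth E; rewrite dE dim_vline w00 /=.
  by move: (\dim _); lia.
suff -> : E = (hyp w0 :&: hyp w)%VS by apply: solid_planes.
apply/eqP; rewrite eqEdim subv_cap !sub_hyp w0E wE /= dE.
rewrite -ltnS dim_cap_hyp ?dim_hyp //.
by rewrite -orth_line orthK.
Qed.

Lemma dvdn_plane (E : {vspace V}) : \dim E = 3%N -> (q %| heavy_count E)%N.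
Proof.
move=> dE; have [mE|mE] := eqVneq (mult E) 0%N.
  by rewrite plane_count // mE muln0 add0n dvdn_mulr.
case: (plane_cases dE mE) => zE; first by rewrite zE dvdn_mulr.
by rewrite -(@dvdn_addl q q) // zE dvdn_mull // dvdn_mulr.
Qed.

Lemma sum_heavy_count (S Y : {vspace V}) :
  (q * (\sum_(w in Y) heavy_count (S :&: hyp w)) + #|Y| * heavy_count (S :&: orth Y)
   = #|Y| * heavy_count S + q * #|Y| * heavy_count (S :&: orth Y))%N.
Proof.
have := sum_card_cap_hyp Y [predI S & heavy].
rewrite sum_cap_hyp.
have E (X : {vspace V}) : #|[predI [predI S & heavy] & X]| = heavy_count (S :&: X).
  apply: eq_card => v.
  by rewrite -[RHS]/((v \in (S :&: X)%VS) && (v \in heavy)) memv_cap andbAC.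
rewrite E => <-; congr (_ * _ + _)%N; apply: eq_bigr => w _; by rewrite E.
Qed.

(** Suppose that a line l with three heavy points lies in a solid off n that is
    not in H. Each plane of the solid on l has more than one heavy point, so lies
    on some solid of H, but not on q of them; by [plane_cases] it has exactly
    q + 1 heavy points. Counting the q^2 + 1 heavy points of the solid along
    these planes leaves only 2 for l. *)
Lemma line_in_elliptic (l : {vspace V}) w0 : \dim l = 2%N -> w0 \in orth l ->
  n \notin hyp w0 -> w0 \notin K -> (heavy_count l < 2 * q)%N.
Proof.
move=> dl w0l nS w0K; rewrite ltnNge; apply/negP => zl.
have w00 : w0 != 0 by apply: contraNneq nS => ->; rewrite mem_hyp dot0r.
have lS : (l <= hyp w0)%VS by rewrite sub_hyp.
have dY : \dim (orth l) = 3%N by have := dim_orth l; lia.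
have E1 := sum_heavy_count (hyp w0) (orth l).
rewrite orthK (capv_idPr lS) cardv dY in E1.
have w0Y : (<[w0]> <= orth l)%VS by rewrite -memvE.
(* The multiples of w0 vanish on the whole solid. *)
have E2 : (\sum_(w in orth l) heavy_count (hyp w0 :&: hyp w)
   = q * heavy_count (hyp w0) + (q ^ 3 - q) * q ^ 2)%N.
  have cP : #|[predI orth l & <[w0]>%VS]| = q.
    have <- : #|<[w0]>%VS| = q by rewrite cardv dim_vline w00 expn1.
    by apply: eq_card => w; rewrite !inE andb_idl // => /(subvP w0Y).
  rewrite (bigID (mem <[w0]>%VS)) /=; congr (_ + _)%N.
    rewrite -cP -sum_nat_const; apply: eq_big => [w|w /andP[_ /vlineP[a ->]]].
      by rewrite inE.
    congr heavy_count; apply/capv_idPl; rewrite sub_hyp.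
    have : w0 \in orth (hyp w0) by rewrite -sub_hyp.
    by move=> /(memvZ a).
  have <- : #|[predD orth l & <[w0]>%VS]| = (q ^ 3 - q)%N.
    by have := cardID <[w0]>%VS (orth l); rewrite cP cardv dY => <-; rewrite addKn.
  rewrite -sum_nat_const; apply: eq_big => [w|w /andP[wl ww0]].
    by rewrite inE andbC.
  have dE : \dim (hyp w0 :&: hyp w) = 3%N.
    apply/eqP; rewrite -eqSS dim_cap_hyp ?dim_hyp //.
    by rewrite -orth_line orthK.
  have nE : n \notin (hyp w0 :&: hyp w)%VS by rewrite memv_cap (negPf nS).
  have lE : (l <= hyp w0 :&: hyp w)%VS by rewrite subv_cap lS sub_hyp.
  have zlE : (heavy_count l <= heavy_count (hyp w0 :&: hyp w))%N.
    apply/subset_leq_card/subsetP => v.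
    by rewrite !inE -!/(_ \in heavy) => /andP[/(subvP lE) -> ->].
  have zm := plane_count dE; rewrite (negPf nE) addn0 muln1 in zm.
  have mlt : (mult (hyp w0 :&: hyp w) + q ^ 1 < q ^ 2)%N.
    have := @mult_lt _ w0 nE; rewrite dE; apply=> //; last by rewrite mem_hypC.
    by rewrite -sub_hyp capvSl.
  have q0 := q_gt0.
  case: (@plane_cases _ dE) => //; rewrite ?expn1 in mlt *.
    by apply/eqP => m0; clear -m0 zm zlE zl q0; lia.
  by rewrite zm; clear -mlt; lia.
have zS := solid_count (dim_hyp w00); rewrite (negPf nS) mult_hyp // (negPf w0K) in zS.
have gq : (0 < g * q ^ 3)%N by rewrite muln_gt0 g_gt0 expn_gt0 q_gt0.
have : (g * q ^ 3 * (heavy_count l + 1) = g * q ^ 3 * (2 * q))%N.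
  have q3 : (q ^ 3 - q = g * (q * (q + 1)))%N.
    by apply/(canLR (addnK q)); rewrite qg; ring.
  have {zS}zE : heavy_count (hyp w0) = (q * (q * g + 1))%N.
    by move: zS; rewrite qg; move: (heavy_count _); clear; lia.
  move: E1; rewrite E2 q3 zE qg; move: (heavy_count _); clear; lia.
move/eqP; rewrite eqn_pmul2l // => /eqP; move: zl; clear; lia.
Qed.

(** If a line off n has more than 2 heavy points, all solids on it that miss n
    are in H, and then [line_count] gives q + 1 heavy points. *)
Lemma line_cases (l : {vspace V}) : \dim l = 2%N -> n \notin l ->
  (heavy_count l < 2 * q)%N \/ heavy_count l = (q ^ 2)%N.
Proof.
move=> dl nl; case: ltnP => [|zl]; [by left | right].
have hK w : w \in orth l -> w \notin hyp n -> w \in K.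
  move=> wl; rewrite mem_hypC => nw; apply: contraLR zl => wK.
  by rewrite -ltnNge; apply: line_in_elliptic wK.
have mE : (mult l + q ^ 2 = q ^ 3)%N by have := mult_full nl hK; rewrite dl.
have := line_count dl; rewrite (negPf nl) mul0n addn0 muln1 => E.
have {}E : (q * (q ^ 2 + heavy_count l) = 2 * (r * q + mult l + r * q))%N.
  by rewrite -E [X in (X * _)%N]qr; ring.
apply/eqP; rewrite -(eqn_pmul2l q_gt0) -(eqn_add2l (q * q ^ 2)) -mulnDr E -expnS.
rewrite -mE; apply/eqP; have : (2 * (r * q) = q ^ 2)%N by rewrite qr; ring.
by move: (mult l) (q ^ 2)%N (r * q)%N; clear; lia.
Qed.

Lemma line_on_n (l : {vspace V}) : \dim l = 2%N -> n \in l -> heavy_count l = q.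
Proof.
move=> dl nl; have := line_count dl; rewrite nl mult_eq0 // => E.
have : (r * (q ^ 2 + heavy_count l) = r * (q ^ 2 + q))%N.
  by rewrite E mul1n qg; ring.
by move/eqP; rewrite eqn_pmul2l ?r_gt0 // eqn_add2l => /eqP.
Qed.

(** Of the q^3 solids on p missing n only (q^3 + q^2)/2 are in H. Another one has
    q^2 + 1 heavy points and no line with more than 2 of them. *)
Lemma secant_exists p : p \in heavy -> p != 0 ->
  exists v, [/\ v \in heavy, v \notin <[p]>%VS
    & (heavy_count (<[p]> + <[v]>) < 2 * q)%N].
Proof.
move=> pZ p0; have pN : p \notin <[n]>%VS.
  by case: (weight_cases p0); rewrite pZ => -[] // _; rewrite lightE p0 /= => ->.
have nP : n \notin <[p]>%VS.
  apply: contra pN => /vlineP[a nE]; have a0 : a != 0.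
    by apply: contraNneq n_neq0 => a0; rewrite nE a0 scale0r.
  by rewrite -[p]scale1r -(mulVf a0) -scalerA -nE memvZ // memv_line.
have [w wp [wn wK]] : exists2 w, w \in hyp p & w \notin hyp n /\ w \notin K.
  have lt : (weight p < #|[predD hyp p & hyp n]|)%N.
    have cE : (#|[predD hyp p & hyp n]| + q ^ 3 = q ^ 4)%N.
      by have := card_orth_off nP; rewrite orth_line dim_vline p0.
    rewrite -(ltn_add2r (q ^ 3)) cE.
    have -> : weight p = (g * (r * (q * (q + 1))))%N.
      by case: (weight_cases p0) => -[-> _ _]; rewrite pZ.
    have : (2 * (g * (r * (q * (q + 1)))) < 2 * (g * q ^ 3))%N.
      have -> : (2 * (g * (r * (q * (q + 1)))) = g * q ^ 2 * (q + 1))%N.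
        by rewrite qr; ring.
      have -> : (2 * (g * q ^ 3) = g * q ^ 2 * (2 * q))%N by ring.
      rewrite ltn_pmul2l; last by rewrite muln_gt0 g_gt0 expn_gt0 q_gt0.
      by have := card_gt1 F; lia.
    by move: (r * _)%N => x; rewrite qg; clear; lia.
  have [/existsP[w /and3P[??]]|] :=
      boolP [exists w in hyp p, (w \notin hyp n) && (w \notin K)].
    by exists w.
  rewrite negb_exists => /forallP nex; move: lt; rewrite ltnNge => /negP[].
  apply/subset_leq_card/subsetP => w; rewrite !inE => /andP[wn wp].
  have := nex w; rewrite wp wn /= negbK => ->.
  by rewrite andbT.
have w0 : w != 0 by apply: contraNneq wn => ->; rewrite mem0v.
have nS : n \notin hyp w by rewrite mem_hypC.
have pS : p \in hyp w by rewrite mem_hypC.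
have lt : (q < heavy_count (hyp w))%N.
  have := solid_count (dim_hyp w0); rewrite (negPf nS) mult_hyp // (negPf wK).
  by rewrite qg; have := g_gt0; move: (heavy_count _); clear; lia.
have [/existsP[v /and3P[vS vZ vp]]|] :=
    boolP [exists v in hyp w, (v \in heavy) && (v \notin <[p]>%VS)].
  exists v; split=> //; apply: (@line_in_elliptic _ w) => //.
    by rewrite dim_add_line // dim_vline p0.
  by rewrite orthD !orth_line wp mem_hypC.
rewrite negb_exists => /forallP nex; move: lt; rewrite ltnNge => /negP[].
have -> : q = #|<[p]>%VS| by rewrite cardv dim_vline p0 expn1.
apply/subset_leq_card/subsetP => v; rewrite inE /= => /andP[vS vZ].
by have := nex v; rewrite vS vZ /= negbK.
Qed.

Lemma n_not_heavy : n \notin heavy.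
Proof.
have : n \in light by rewrite lightE n_neq0 memv_line.
by case: (weight_cases n_neq0) => -[_ -> _ ->].
Qed.

Lemma heavy_count_full (X : {vspace V}) :
  (forall v, v \in X -> v \in heavy) -> heavy_count X = #|X|.
Proof.
move=> XZ; apply: eq_card => v.
by rewrite -[LHS]/((v \in X) && (v \in heavy)) andb_idr //; exact: XZ.
Qed.

(** * Recognising the solids of H *)

Section Form.

Variable A : 'M[F]_5.
Hypothesis heavyE : forall v, (v \in heavy) = (qform A v == 0).
Hypothesis A_nonsing : nonsingular_on A fullv.
Hypothesis A_n : forall v, polar A v n = 0.
Hypothesis A_radical : forall S : {vspace V}, \dim S = 4%N -> n \in S -> exists p,
  [/\ p \in S, p != 0, p \in heavy & forall s, s \in S -> polar A p s = 0].
Variable Q : {set point F}.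
Hypothesis Q_heavy : forall v (v0 : v != 0), (pt v0 \in Q) = (v \in heavy).

Lemma quadric_restrict (U : {vspace V}) :
  [set P in Q | (val P <= U)%VS] = quadric_points A U.
Proof.
apply/setP => P; have [v [v0 ->]] := pointP P.
by rewrite mem_quadric inE Q_heavy heavyE /= -memvE andbC.
Qed.

(** n is in the radical of the polar form, so a vector perpendicular to a
    complement of <n> is perpendicular to everything. *)
Lemma nonsingular_off_n w : n \notin hyp w -> nonsingular_on A (hyp w).
Proof.
move=> nS v vS Av hv; apply: A_nonsing => // [|u _]; first exact: memvf.
have dn : dot n w != 0 by rewrite -mem_hyp.
pose t := dot u w / dot n w.
have uS : u - t *: n \in hyp w.
  by rewrite mem_hyp -scaleNr dotDl dotZl mulNr /t divfK // subrr.
have := hv _ uS; rewrite !polar_dot -scaleNr dotDl dotZl.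
by rewrite -[dot n _]polar_dot A_n mulr0 addr0.
Qed.

Lemma g_powers : [/\ (0 < g)%N, (0 < g ^ 2)%N, (0 < g ^ 3)%N & (0 < g ^ 4)%N].
Proof. by rewrite !expn_gt0 g_gt0. Qed.

(** A plane of a solid of H has at most 2q + 1 heavy points. *)
Lemma singular_plane_free (W : {vspace V}) w : w \in K -> (W <= hyp w)%VS ->
  (forall v, v \in W -> v \in heavy) -> (\dim W <= 2)%N.
Proof.
move=> wK WS WZ; rewrite leqNgt; apply/negP => dW.
have w0 : w != 0 by apply: contraNneq K0 => <-.
have nS := K_off_n wK.
have nW : n \notin W by apply: contra nS; apply: subvP.
have zW := heavy_count_full WZ; rewrite cardv in zW.
have := dimvS WS; rewrite dim_hyp // leq_eqVlt => /orP[/eqP dW4|].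
  have mW : (mult W + 1 <= q)%N by have := mult_le nW; rewrite dW4.
  have := solid_count dW4; rewrite zW dW4 (negPf nW).
  have := leq_mul (leqnn (2 * q)) mW; have [] := g_powers; rewrite qg mul0n addn0.
  by move: (mult W); clear; lia.
rewrite ltnS => dW3; have {dW dW3}dW : \dim W = 3%N by apply/eqP; rewrite eqn_leq dW dW3.
have mW : (mult W + q ^ 1 <= q ^ 2)%N by have := mult_le nW; rewrite dW.
have := plane_count dW; rewrite zW dW (negPf nW) mul0n addn0; have [] := g_powers.
move: mW.
by rewrite qg; move: (mult W); clear; lia.
Qed.

(** For a heavy p in the solid, the perp of p cuts the solid in a plane, which
    has at least q + 1 heavy points since it lies in a solid of H; any heavy v
    in it other than p spans with p a line of Q. *)
Lemma full_line w : w \in K -> exists p v,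
  [/\ p \in hyp w, v \in hyp w, p != 0, v \notin <[p]>%VS &
   [/\ qform A p = 0, qform A v = 0 & polar A p v = 0]].
Proof.
move=> wK; have w0 : w != 0 by apply: contraNneq K0 => <-.
have nS := K_off_n wK.
have [p [pS p0 pZ]] : exists p, [/\ p \in hyp w, p != 0 & p \in heavy].
  have := solid_count (dim_hyp w0); rewrite heavy_count_predD1 (negPf nS) mult_hyp // wK.
  case: (posnP #|[predD1 [predI hyp w & heavy] & 0]|) => [->|].
    by have [] := g_powers; rewrite qg; clear; lia.
  by move=> /card_gt0P[p /and3P[? ? ?]] _; exists p.
pose u := p *m (A + A^T).
have pu v : (v \in hyp u) = (polar A p v == 0) by rewrite mem_hyp polar_dot.
have nu : n \in hyp u by rewrite pu A_n.
have uS : u \notin orth (hyp w).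
  rewrite -sub_hyp; apply/negP => /subvP sub; case/eqP: p0.
  apply: (nonsingular_off_n nS) => //; first by apply/eqP; rewrite -heavyE.
  by move=> v /sub; rewrite pu => /eqP.
have dE : \dim (hyp w :&: hyp u) = 3%N.
  by apply/eqP; rewrite -eqSS dim_cap_hyp // dim_hyp.
have mE : mult (hyp w :&: hyp u) != 0%N.
  rewrite -lt0n; apply/card_gt0P; exists w.
  by rewrite inE /= wK -sub_hyp capvSl.
have lt : (q < heavy_count (hyp w :&: hyp u))%N.
  have q1 := card_gt1 F; case: (plane_cases dE mE) => zE.
    by rewrite zE -[X in (X < _)%N]expn1 ltn_exp2l.
  by move: zE q1; rewrite qg; move: (heavy_count _); clear; nia.
have [/existsP[v /andP[/andP[vE vZ] vp]]|] :=
    boolP [exists v, (v \in (hyp w :&: hyp u)%VS) && (v \in heavy)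
                     && (v \notin <[p]>%VS)].
  move: vE; rewrite memv_cap pu => /andP[vS /eqP pv].
  by exists p, v; split=> //; split=> //; apply/eqP; rewrite -heavyE.
rewrite negb_exists => /forallP nex; move: lt; rewrite ltnNge => /negP[].
have -> : q = #|<[p]>%VS| by rewrite cardv dim_vline p0 expn1.
apply/subset_leq_card/subsetP => v /andP[/= vS vZ].
by have := nex v; rewrite vS vZ /= negbK.
Qed.

Lemma K_hyperbolic w : w \in K ->
  hyperbolic_quadric (hyp w) [set P in Q | (val P <= hyp w)%VS].
Proof.
move=> wK; have w0 : w != 0 by apply: contraNneq K0 => <-.
exists A; split; first exact/nonsingular_off_n/K_off_n; last exact: quadric_restrict.
rewrite dim_hyp //; suff -> : witt_index_on A (hyp w) = 2%N by [].
apply/eqP; rewrite eqn_leq; apply/andP; split.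
  apply/bigmax_leqP => W /andP[WS /totally_singularP WZ].
  by apply: singular_plane_free wK WS _ => v /WZ; rewrite heavyE => ->.
have [p [v [pS vS p0 vp [Ap Av pv]]]] := full_line wK.
have d2 : \dim (<[p]> + <[v]>)%VS = 2%N by rewrite dim_add_line // dim_vline p0.
rewrite -[X in (X <= _)%N]d2; apply: leq_bigmax_cond; rewrite subv_add -!memvE pS vS /=.
apply/totally_singularP => _ /memv_addP[_ /vlineP[a ->] [_ /vlineP[b ->] ->]].
rewrite qformD !qformZ Ap Av !mulr0 !add0r.
by rewrite polar_dot dotZl -scalemxAl dotZr -polar_dot pv !mulr0.
Qed.

(** Suppose that the solid is not in H. If it contains n, it is the tangent
    hyperplane of some p in Q, so each line on p in it either lies in Q or meets
    Q in p only; then p is a singular point of every form B with the same zeros.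
    If it misses n, a totally singular line for B would be a line of Q, against
    [line_in_elliptic]. *)
Lemma hyperbolic_K w : w != 0 ->
  hyperbolic_quadric (hyp w) [set P in Q | (val P <= hyp w)%VS] -> w \in K.
Proof.
move=> w0 [B [B_nonsing wittB QB]]; apply/negPn/negP => wK.
have BZ v : v \in hyp w -> (qform B v == 0) = (v \in heavy).
  have [->|v0] := eqVneq v 0; first by rewrite qform0 eqxx heavy0.
  move=> vS; have /setP/(_ (pt v0)) := QB.
  by rewrite mem_quadric vS inE Q_heavy /= -memvE vS andbT => ->.
have [nS|nS] := boolP (n \in hyp w).
  have [p [pS p0 pZ hp]] := A_radical (dim_hyp w0) nS.
  case/eqP: p0; apply: B_nonsing => //; first by apply/eqP; rewrite BZ.
  move=> s sS.
  have Zt t : (s + t *: p \in heavy) = (s \in heavy).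
    rewrite !heavyE qformD qformZ.
    have -> : qform A p = 0 by apply/eqP; rewrite -heavyE.
    have -> : polar A s (t *: p) = 0.
      by rewrite polar_dot dotZl -polar_dot polarC hp // mulr0.
    by rewrite mulr0 !addr0.
  have Bp : qform B p = 0 by apply/eqP; rewrite BZ.
  have Bt t : (qform B s + t * polar B p s == 0) = (qform B s == 0).
    rewrite BZ // -(Zt t) -BZ; last by rewrite memvD ?memvZ.
    rewrite qformD qformZ Bp mulr0 addr0.
    by rewrite [in RHS]polar_dot dotZl -polar_dot polarC.
  apply/eqP; have [Bs|Bs] := eqVneq (qform B s) 0.
    by have := Bt 1; rewrite Bs eqxx add0r mul1r.
  (* A second zero of B on the line through p and s. *)
  apply: contraT => pol; have := Bt (- (qform B s / polar B p s)).
  by rewrite mulNr divfK // subrr eqxx (negPf Bs).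
have [W /andP[WS /totally_singularP WB] dW] :
    exists2 W : {vspace V}, (W <= hyp w)%VS && totally_singular B W & \dim W = 2%N.
  have : (0 < #|[pred W : {vspace V} | (W <= hyp w)%VS && totally_singular B W]|)%N.
    apply/card_gt0P; exists 0%VS; rewrite inE sub0v /=.
    by apply/totally_singularP => v; rewrite memv0 => /eqP ->; apply: qform0.
  move=> /(eq_bigmax_cond (fun W : {vspace V} => \dim W))[W WP dW].
  exists W => //; apply: double_inj; rewrite -dW.
  by move: wittB; rewrite dim_hyp.
have := line_in_elliptic dW _ nS wK; rewrite -sub_hyp => /(_ WS).
rewrite heavy_count_full => [|v vW]; last by rewrite -BZ ?WB ?eqxx // (subvP WS).
rewrite cardv dW expnS expn1 ltn_mul2r q_gt0 /=.
by rewrite ltnNge card_gt1.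
Qed.

End Form.

Lemma hyperbolic_solids (Q : {set point F}) : 2%N \in [pchar F] ->
    (forall v (v0 : v != 0), (pt v0 \in Q) = (v \in heavy)) ->
  nonsingular_quadric fullv Q /\
  forall w, w != 0 -> (w \in K <->
    hyperbolic_quadric (hyp w) [set P in Q | (val P <= hyp w)%VS]).
Proof.
move=> char2 Q_heavy.
have [A [heavyE A_ns A_n A_rad]] := quadratic_set char2 heavy0 heavy_scaled
  n_not_heavy dvdn_plane line_cases line_on_n secant_exists.
split; last first.
  by move=> w w0; split; [apply: (K_hyperbolic heavyE) | apply: (hyperbolic_K heavyE)].
exists A => //; rewrite -(quadric_restrict heavyE Q_heavy); apply/setP => P.
by rewrite inE subvf andbT.
Qed.

End Counting.

(** * Solids and functionals *)

Section Functionals.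

Variables (F : finFieldType) (g : nat) (qg : #|F| = (g + 1)%N).
Local Notation V := 'rV[F]_5.
Local Notation q := #|F|.
Variable H : {set solid F}.

Definition functionals : {set V} :=
  [set w | (w != 0) && [exists S in H, val S == hyp w]].

Lemma solid_hyp (S : solid F) : exists2 w, w != 0 & val S = hyp w.
Proof.
have dO : \dim (orth (val S)) = 1%N.
  by apply/eqP; rewrite -(eqn_add2l 4) -{1}(eqP (valP S)) dim_orth.
have w0 : vpick (orth (val S)) != 0 by rewrite vpick0 -dimv_eq0 dO.
exists (vpick (orth (val S))) => //; apply/eqP; rewrite eqEdim sub_hyp memv_pick.
by rewrite dim_hyp // (eqP (valP S)).
Qed.

Lemma functionalsE (S : solid F) w : w != 0 -> val S = hyp w ->
  (w \in functionals) = (S \in H).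
Proof.
move=> w0 Sw; rewrite inE w0 /=; apply/existsP/idP => [[T /andP[TH /eqP Tw]]|SH].
  by rewrite (_ : S = T) //; apply: val_inj; exact: etrans Sw (esym Tw).
by exists S; rewrite SH Sw eqxx.
Qed.

(** Each solid is the kernel of q - 1 functionals. *)
Lemma card_functionals (X : {vspace V}) :
  #|[predI functionals & orth X]| = (g * #|[set S in H | (X <= val S)%VS]|)%N.
Proof.
transitivity (\sum_(w in [predI functionals & orth X])
    \sum_(S in [set S in H | (X <= val S)%VS]) (val S == hyp w))%N.
  rewrite -sum1_card; apply: eq_bigr => w /andP[/= wK wX].
  have /existsP[S /andP[SH Sw]] : [exists S in H, val S == hyp w].
    by move: wK; rewrite inE => /andP[].
  rewrite (bigD1 S) /=; last by rewrite inE SH (eqP Sw) sub_hyp.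
  rewrite Sw big1 // => T /andP[_ TS]; apply/eqP; rewrite eqb0.
  by apply: contra TS => /eqP Tw; apply/eqP/val_inj; exact: etrans Tw (esym (eqP Sw)).
rewrite exchange_big mulnC -sum_nat_const; apply: eq_bigr => S.
rewrite inE => /andP[SH XS].
have cO : #|orth (val S)| = q.
  rewrite cardv -[RHS]expn1; congr (_ ^ _)%N.
  by have := dim_orth (val S); rewrite (eqP (valP S)); lia.
have -> : g = #|[predD1 orth (val S) & 0]|.
  by have := cardD1 (0 : V) (orth (val S)); rewrite mem0v cO qg addn1 => -[].
rewrite -sum1_card big_mkcond [RHS]big_mkcond; apply: eq_bigr => w _.
rewrite !inE /=; have [->|w0] := eqVneq w 0; first by [].
have -> : (w \in orth (val S)) = (val S == hyp w).
  apply/idP/eqP => [wS|->]; last by rewrite -sub_hyp.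
  by apply/eqP; rewrite eqEdim sub_hyp wS dim_hyp // (eqP (valP S)).
have [Sw|] := eqVneq (val S) (hyp w); last by rewrite !andbF; case: ifP.
have -> : [exists T in H, val T == hyp w].
  by apply/existsP; exists S; rewrite SH Sw eqxx.
by rewrite -sub_hyp -Sw XS.
Qed.

End Functionals.

Local Close Scope ring_scope.

Theorem theorem1p5 (F : finFieldType) (q : nat) (F_order : #|F| = q)
    (q_even : ~~ odd q) (H : {set solid F}) (H_nonempty : H != set0)
    (cond_I : forall P : point F,
       [\/ #|solids_through H P| = 0,
           #|solids_through H P| = q ^ 3 %/ 2
         | #|solids_through H P| = (q ^ 3 + q ^ 2) %/ 2])
    (cond_II : forall (E : plane F) (S : solid F),
       S \in H -> inside E S -> q %/ 2 <= #|solids_through H E|) :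
  let Q := [set P : point F | #|solids_through H P| == (q ^ 3 + q ^ 2) %/ 2] in
  nonsingular_quadric fullv Q /\
  (forall S : solid F,
     S \in H <-> hyperbolic_quadric (val S) [set P in Q | inside P S]).
Proof.
move=> Q; subst q.
have [p pr_p charF] := finPcharP F.
have qe := card_pprimeChar charF; set e := logn p _ in qe.
have p2 : p = 2.
  move: q_even; rewrite [#|F|]qe oddX negb_or => /andP[_].
  by case: (even_prime pr_p) => // ->.
subst p; have q2 := card_gt1 F.
pose r := (#|F| %/ 2); pose g := #|F|.-1.
have qr : #|F| = (r * 2) by rewrite divnK // dvdn2.
have qg : #|F| = (g + 1) by rewrite addn1 prednK // ltnW.
pose K := functionals H.
have K0 : 0%R \notin K by rewrite inE eqxx.
have KZ a v : a != 0%R -> v \in K -> (a *: v)%R \in K.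
  move=> a0; rewrite !inE => /andP[v0 /existsP[S /andP[SH /eqP Sv]]].
  rewrite scaler_eq0 (negPf a0) v0 /=; apply/existsP; exists S; rewrite SH Sv.
  by apply/eqP/vspaceP => u; rewrite !mem_hyp dotZr mulf_eq0 (negPf a0).
have K_neq0 : K != set0.
  have /set0Pn[S SH] := H_nonempty; have [w w0 Sw] := solid_hyp S.
  by apply/set0Pn; exists w; rewrite (functionalsE H w0 Sw).
have st k (X : projsub F k) :
    #|[predI K & orth (val X)]| = (g * #|solids_through H X|).
  by rewrite (card_functionals qg).
have hst v (v0 : v != 0%R) : weight K v = (g * #|solids_through H (pt v0)|).
  by rewrite -st /= orth_line.
have K_card : exists k0, #|K| = (g * k0).
  exists #|[set S in H | (0%VS <= val S)%VS]|.
  rewrite -(card_functionals qg); apply: eq_card => w.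
  rewrite -[RHS]/((w \in K) && (w \in orth 0%VS)) andb_idr // => _.
  by rewrite -sub_hyp sub0v.
have [k0 Kk0] := K_card.
have mid : (#|F| ^ 3 %/ 2 = r * #|F| ^ 2).
  by rewrite [X in (X ^ 3)]qr -(@mulnK (r * #|F| ^ 2) 2) // qr; congr (_ %/ _); ring.
have big : ((#|F| ^ 3 + #|F| ^ 2) %/ 2 = r * (#|F| * (#|F| + 1))).
  by rewrite -(@mulnK (r * (#|F| * (#|F| + 1))) 2) //; congr (_ %/ _); rewrite qr; ring.
have condI v : v != 0%R -> [\/ weight K v = 0, weight K v = (g * (r * #|F| ^ 2))
    | weight K v = (g * (r * (#|F| * (#|F| + 1))))].
  move=> v0; rewrite (hst v v0) -mid -big; case: (cond_I (pt v0)) => ->.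
  - by constructor 1; rewrite muln0.
  - by constructor 2.
  by constructor 3.
have condII (E : {vspace 'rV[F]_5}) : \dim E = 3 -> mult K E != 0 -> (g * r <= mult K E).
  move=> dE; rewrite -lt0n => /card_gt0P[w]; rewrite inE /= => /andP[wK wE].
  have dE' : \dim E == 3 by rewrite dE.
  have := st _ (Sub E dE' : plane F); rewrite /= => E1; rewrite /mult E1 leq_mul2l.
  move: wK; rewrite inE => /andP[w0 /existsP[S /andP[SH /eqP Sw]]].
  by apply/orP; right; apply: (cond_II _ S) => //; rewrite /inside /= Sw sub_hyp.
have [n n0 N0E] := nucleus_exists qr qg qe K0 KZ K_neq0 Kk0 condI.
have QZ v (v0 : v != 0%R) : (pt v0 \in Q) = (v \in heavy r g K).
  rewrite !inE (negPf v0) (hst v v0) big /= eqn_mul2l.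
  by rewrite (negPf (_ : g != 0)) // -lt0n -(ltn_add2r 1) -qg.
have [nsQ hypQ] := hyperbolic_solids qr qg qe K0 KZ K_neq0 Kk0 condI condII
  n0 N0E charF QZ.
split=> // S; have [w w0 Sw] := solid_hyp S.
rewrite -(functionalsE H w0 Sw) (hypQ w w0) -Sw.
by split.
Qed.
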